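(* There is an algorithm that, given a multi-path matroid on an $n$-element ground set (specified by a presentation by an antichain of $\sigma$-intervals for a cyclic permutation $\sigma$ of the ground set), computes its Tutte polynomial $t(M;x,y)$ using $\mathcal{O}(n^6)$ operations.
   Context: A set system on a finite set $S$ is a multiset $\mathcal{A}=(A_j:j\in J)$ of subsets of $S$; its partial transversals (sets $\{x_k:k\in K\}$ of $|K|$ distinct elements with $K\subseteq J$ and $x_k\in A_k$) are the independent sets of the transversal matroid $M[\mathcal{A}]$, and $\mathcal{A}$ is a presentation of it. For a cyclic permutation $\sigma$ of $S$, a $\sigma$-interval is a nonempty set $\{f,\sigma(f),\ldots,l\}$ ($f$ first element, $l$ last element). An antichain is a set system none of whose members contains another. A multi-path matroid is a transversal matroid with a presentation by an antichain of $\sigma$-intervals for some cyclic permutation $\sigma$ of its ground set. The Tutte polynomial of a matroid $M$ on $S$ with rank function $r$ is $t(M;x,y)=\sum_{A\subseteq S}(x-1)^{r(S)-r(A)}(y-1)^{|A|-r(A)}$. *)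

(* Defs.v *)
From HB Require Import structures.
From mathcomp Require Import all_boot all_order all_algebra all_fingroup.

Set Implicit Arguments.
Unset Strict Implicit.
Unset Printing Implicit Defensive.

Import GRing.Theory Num.Theory.

Section SetSystems.
Variables (S J : finType).

(* A set system is a family A : J -> {set S}, hence a multiset of subsets. *)

(* The choice k |-> x_k is a function on K only, so that the empty set is a
   partial transversal even when S is empty and J is not. *)
Definition partial_transversal (A : J -> {set S}) (X : {set S}) : bool :=
  [exists K : {set J}, exists x : {ffun {k : J | k \in K} -> S},
    [&& injectiveb x, [forall k, x k \in A (val k)] & X == x @: setT]].

(* A matroid is represented by its collection of independent sets. *)
Definition transversal_matroid (A : J -> {set S}) : {set {set S}} :=
  [set X | partial_transversal A X].

Definition antichain (A : J -> {set S}) : Prop :=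
  forall i j, i != j -> ~~ (A i \subset A j).

End SetSystems.

Section Intervals.
Variables (S : finType) (sigma : {perm S}).

Definition cyclic_perm : Prop := forall x y, y \in porbit sigma x.

(* {f, sigma f, ..., l}; findex is the least k with sigma^k f = l. *)
Definition sigma_interval (f l : S) : {set S} :=
  [set x in traject sigma f (findex sigma f l).+1].

End Intervals.

Section Tutte.
Variables (S : finType) (M : {set {set S}}).

Definition mrank (A : {set S}) : nat :=
  \max_(I : {set S} | (I \in M) && (I \subset A)) #|I|.

Local Open Scope ring_scope.

(* Polynomials in x and y are elements of {poly {poly int}}, with x = 'X the
   outer variable and y = 'X%:P the inner one. *)
Definition tutte : {poly {poly int}} :=
  \sum_(A : {set S})
     ('X - 1) ^+ (mrank [set: S] - mrank A) * ('X%:P - 1) ^+ (#|A| - mrank A).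

End Tutte.

(* The machine model is a unit-cost random access machine in structured form:
   integer variables, integer arrays with computed (indirect) indices, addition,
   subtraction and comparison.  There is no unit-cost multiplication, which on
   unbounded integers would make the model unreasonably strong. *)

Inductive aexp :=
| ANum of int
| AVar of nat
| AGet of nat & aexp
| AAdd of aexp & aexp
| ASub of aexp & aexp.

Inductive bexp :=
| BLe of aexp & aexp
| BNot of bexp
| BAnd of bexp & bexp.

Inductive cmd :=
| CSkip
| CAssign of nat & aexp
| CStore of nat & aexp & aexp
| CSeq of cmd & cmd
| CIf of bexp & cmd & cmd
| CWhile of bexp & cmd.

Record state := State { vars : nat -> int; arrs : nat -> int -> int }.

Fixpoint aeval (s : state) (e : aexp) : int :=
  match e with
  | ANum z => z
  | AVar x => vars s x
  | AGet a e1 => arrs s a (aeval s e1)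
  | AAdd e1 e2 => (aeval s e1 + aeval s e2)%R
  | ASub e1 e2 => (aeval s e1 - aeval s e2)%R
  end.

Fixpoint beval (s : state) (b : bexp) : bool :=
  match b with
  | BLe e1 e2 => (aeval s e1 <= aeval s e2)%R
  | BNot b1 => ~~ beval s b1
  | BAnd b1 b2 => beval s b1 && beval s b2
  end.

(* Every constant, variable read, array read, arithmetic operation, comparison
   and connective counts as one operation. *)
Fixpoint acost (e : aexp) : nat :=
  match e with
  | ANum _ | AVar _ => 1
  | AGet _ e1 => (acost e1).+1
  | AAdd e1 e2 | ASub e1 e2 => (acost e1 + acost e2).+1
  end.

Fixpoint bcost (b : bexp) : nat :=
  match b with
  | BLe e1 e2 => (acost e1 + acost e2).+1
  | BNot b1 => (bcost b1).+1
  | BAnd b1 b2 => (bcost b1 + bcost b2).+1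
  end.

Definition set_var (s : state) (x : nat) (z : int) : state :=
  State (fun y => if y == x then z else vars s y) (arrs s).

Definition set_arr (s : state) (a : nat) (i z : int) : state :=
  State (vars s)
    (fun b j => if (b == a) && (j == i) then z else arrs s b j).

(* exec c s k s': started in s, c halts in s' after k operations. *)
Inductive exec : cmd -> state -> nat -> state -> Prop :=
| ExecSkip s : exec CSkip s 1 s
| ExecAssign s x e :
    exec (CAssign x e) s (acost e).+1 (set_var s x (aeval s e))
| ExecStore s a e1 e2 :
    exec (CStore a e1 e2) s (acost e1 + acost e2).+1
      (set_arr s a (aeval s e1) (aeval s e2))
| ExecSeq s1 s2 s3 c1 c2 k1 k2 :
    exec c1 s1 k1 s2 -> exec c2 s2 k2 s3 ->
    exec (CSeq c1 c2) s1 (k1 + k2) s3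
| ExecIf s1 s2 b c1 c2 k :
    exec (if beval s1 b then c1 else c2) s1 k s2 ->
    exec (CIf b c1 c2) s1 (bcost b + k).+1 s2
| ExecWhileFalse s b c :
    ~~ beval s b -> exec (CWhile b c) s (bcost b).+1 s
| ExecWhileTrue s1 s2 s3 b c k1 k2 :
    beval s1 b -> exec c s1 k1 s2 -> exec (CWhile b c) s2 k2 s3 ->
    exec (CWhile b c) s1 (bcost b + k1 + k2).+1 s3.

Lemma exec_det c s k1 s1 k2 s2 :
  exec c s k1 s1 -> exec c s k2 s2 -> k1 = k2 /\ s1 = s2.
Proof.
move=> H; elim: H k2 s2 => {c s k1 s1}.
- by move=> s k2 s2 H; inversion H.
- by move=> s x e k2 s2 H; inversion H.
- by move=> s a e1 e2 k2 s2 H; inversion H.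
- move=> s1 s2 s3 c1 c2 k1 k2 _ IH1 _ IH2 k s H.
  inversion H as [| | |? ? ? ? ? ? ? E1 E2| | |]; subst.
  have [-> E] := IH1 _ _ E1; subst.
  by have [-> ->] := IH2 _ _ E2.
- move=> s1 s2 b c1 c2 k _ IH k' s' H.
  inversion H as [| | | |? ? ? ? ? ? E1| |]; subst.
  by have [-> ->] := IH _ _ E1.
- move=> s b c /negP nb k s' H.
  by inversion H.
- move=> s1 s2 s3 b c k1 k2 hb _ IH1 _ IH2 k s H.
  inversion H as [| | | | |? ? ? nb|? ? ? ? ? ? ? _ E1 E2]; subst.
    by rewrite hb in nb.
  have [-> E] := IH1 _ _ E1; subst.
  by have [-> ->] := IH2 _ _ E2.
Qed.

Definition arr_of_seq (t : seq int) (i : int) : int :=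
  if i is Posz k then nth 0%R t k else 0%R.

(* Elements of S are numbered 0, ..., #|S| - 1. *)
Definition elt_code (S : finType) (x : S) : int := Posz (enum_rank x).

(* Input: variables 0 and 1 hold #|S| and the number m of intervals; arrays 0, 1
   and 2 hold sigma and the first and last elements of the intervals.  All other
   cells are 0. *)
Definition input_state (S : finType) (sigma : {perm S}) (m : nat)
    (f l : 'I_m -> S) : state :=
  State
    (fun x => match x with 0 => Posz #|S| | 1 => Posz m | _ => 0%R end)
    (fun a => match a with
       | 0 => arr_of_seq [seq elt_code (sigma x) | x <- enum S]
       | 1 => arr_of_seq [seq elt_code (f j) | j <- enum 'I_m]
       | 2 => arr_of_seq [seq elt_code (l j) | j <- enum 'I_m]
       | _ => fun=> 0%R
       end).

(* Output: for i, j <= n, cell i * (n + 1) + j of array 3 is the coefficient of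
   x^i y^j.  The degree of the Tutte polynomial in each variable is at most n. *)
Definition output_poly (n : nat) (s : state) : {poly {poly int}} :=
  (\sum_(i < n.+1) \sum_(j < n.+1)
     (arrs s 3 (Posz (i * n.+1 + j)%N))%:P%:P * 'X ^+ i * 'X%:P ^+ j)%R.

Definition bigO (T g : nat -> nat) : Prop :=
  exists C N : nat, forall n, N <= n -> T n <= C * g n.

(* Main.v *)
Require Import Defs.
From mathcomp Require Import all_boot all_order all_algebra all_fingroup.
From mathcomp Require Import zify ring.

(* Cut the cycle open and number the elements 0, ..., n - 1.  An antichain of
   intervals is sorted by first and by last elements at the same time, so the
   intervals unroll to a sequence indexed by the integers, interval k + m being
   interval k one turn later; those containing t are the k with
   lo t <= k < hi t.  Scan a subset B with a pointer p to the next unused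
   interval: at time t the intervals in [p, lo t) expire, and an element t of B
   either is matched to the interval p < hi t, and p is incremented, or is
   blocked because p = hi t.  If one turn leads from a pointer s to s + m, each
   interval is passed once, and the matching is maximum by Koenig's argument:
   take the elements whose next event is an expiry and the intervals matched
   when the next event is a block.  So r(M) - r(B) counts the expiries and
   |B| - r(B) the blocks.

   The pointer after one turn grows by 0 or 1 when s grows by 1, by 0 exactly
   when the upper path touches lo or is blocked.  Hence exactly one s is both
   fixed and touching, and the Tutte polynomial is the sum over s of the
   (x - 1)^expiries (y - 1)^blocks of the fixed touching paths from s, a sum
   that a dynamic program over (s, t, p) evaluates; with the coefficients of
   x^i y^j this makes O(n^5) table entries. *)

Set Implicit Arguments.
Unset Strict Implicit.
Unset Printing Implicit Defensive.
Import GRing.Theory Num.Theory.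

(** * Greedy scan and its dynamic program *)

Section Greedy.
Variables lo hi : nat -> nat.

Definition gstep t p (b : bool) : nat :=
  maxn p (lo t) + (b && (maxn p (lo t) < hi t)).

Fixpoint gfinal t p w : nat :=
  if w is b :: w' then gfinal t.+1 (gstep t p b) w' else maxn p (lo t).

Fixpoint nexpired t p w : nat :=
  (lo t - p) + if w is b :: w' then nexpired t.+1 (gstep t p b) w' else 0.

Fixpoint nblocked t p w : nat :=
  if w is b :: w' then
    (b && (hi t <= maxn p (lo t))) + nblocked t.+1 (gstep t p b) w'
  else 0.

(** The test is [p <= lo t] and not a strict one: a pointer sitting on [lo t] loses nothing, but the
    path started one lower is lifted onto it. *)
Fixpoint touches t p w : bool :=
  (p <= lo t) ||
  (if w is b :: w' then
     (b && (hi t <= maxn p (lo t))) || touches t.+1 (gstep t p b) w'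
   else false).

(** Conservation: the pointer moves only by expiries and matches, and each element of the word is
    either matched or blocked. *)
Lemma gfinal_count t p w :
  gfinal t p w + nblocked t p w = p + nexpired t p w + count id w.
Proof.
elim: w t p => [|b w IH] t p /=; first lia.
have e : gstep t p b = maxn p (lo t) + (b && (maxn p (lo t) < hi t)) by [].
by have := IH t.+1 (gstep t p b); move: e; case: b => /= e; lia.
Qed.

Lemma nblocked_le t p w : nblocked t p w <= count id w.
Proof.
elim: w t p => [|b w IH] t p //=.
by have := IH t.+1 (gstep t p b); case: b => /=; lia.
Qed.

Hypothesis lo_le_hi : forall t, lo t <= hi t.
Hypothesis hi_mono : forall t, hi t <= hi t.+1.

Lemma gstep_le_hi t p b : p <= hi t -> gstep t p b <= hi t.+1.
Proof. by have := lo_le_hi t; have := hi_mono t; rewrite /gstep; lia. Qed.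

(* Paths started one apart merge exactly when the upper one is
   overtaken by an expiry or stopped at hi. *)
Lemma gfinal_succ t p w :
  p < hi t -> gfinal t p.+1 w = gfinal t p w + ~~ touches t p.+1 w.
Proof.
elim: w t p => [|b w IH] t p lt_p_hi /=; first lia.
have [le_p_lo|lt_lo_p] /= := boolP (p < lo t).
  by rewrite addn0 /gstep; have -> : maxn p (lo t) = maxn p.+1 (lo t) by lia.
have [bb|bb] /= := boolP (b && _).
  rewrite addn0; congr (gfinal _ _ _); rewrite /gstep.
  by move/andP: bb => [-> bb] /=; lia.
have -> : gstep t p.+1 b = (gstep t p b).+1.
  by move: bb; rewrite /gstep; case: b => /=; lia.
apply: IH.
by move: bb; have := hi_mono t; rewrite /gstep; case: b => /=; lia.
Qed.

Lemma gfinal_ge t p w : lo (t + size w) <= gfinal t p w.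
Proof.
elim: w t p => [|b w IH] t p /=; first by rewrite addn0 leq_maxr.
by rewrite addnS -addSn; apply: IH.
Qed.

Lemma gfinal_le t p w : p <= hi t -> gfinal t p w <= hi (t + size w).
Proof.
elim: w t p => [|b w IH] t p /= le_p; first by rewrite addn0 geq_max le_p lo_le_hi.
by rewrite addnS -addSn; apply/IH/gstep_le_hi.
Qed.

(** Let g(s) be the final pointer. As g grows by 0 or 1 at each step, g(s) - s never increases; it
    is at least m at s = 0 and at most m at s = [hi 0]. The wanted start is the least s with g(s) <=
    s + m. A later fixed start cannot touch, since g would have to be constant on the step into
    it. *)
Lemma fixed_start_unique m (w : seq bool) :
  lo 0 = 0 -> m <= lo (size w) -> hi (size w) <= hi 0 + m ->
  exists2 s : nat, s <= hi 0 &
    forall s', s' <= hi 0 ->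
      touches 0 s' w && (gfinal 0 s' w == s' + m) = (s' == s).
Proof.
move=> lo0 lon hin.
have ex : exists s, gfinal 0 s w <= s + m.
  by exists (hi 0); apply: leq_trans hin; rewrite -[size w]add0n gfinal_le.
case: (ex_minnP ex) => s le_s min_s.
have le_s_hi : s <= hi 0.
  by apply: min_s; apply: leq_trans hin; rewrite -[size w]add0n gfinal_le.
have lip p d : p + d <= hi 0 -> gfinal 0 (p + d) w <= gfinal 0 p w + d.
  elim: d => [|d IH] h; first by rewrite !addn0.
  by rewrite addnS gfinal_succ; [have := IH; lia|lia].
have fs : gfinal 0 s w = s + m /\ touches 0 s w.
  (* At s = 0 equality comes from [m <= lo (size w)] and the touch from [lo 0 = 0]; otherwise
     minimality leaves g no room to grow on the step into s. *)
  case: s le_s min_s le_s_hi => [|s] le_s min_s le_s_hi.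
    have := gfinal_ge 0 0 w; rewrite add0n => h; split; first lia.
    by case: (w).
  have gt_s : s + m < gfinal 0 s w by rewrite ltnNge; apply/negP => /min_s; lia.
  have := gfinal_succ w le_s_hi; case: touches; lia.
exists s => // s' le_s'; apply/andP/eqP => [[ts' /eqP fs']|->]; last first.
  by case: fs => -> ->.
have le_ss' : s <= s' by apply: min_s; rewrite fs'.
case: s' le_s' ts' fs' le_ss' => [|s'] le_s' ts' fs' le_ss'; first lia.
case: (ltngtP s s'.+1) le_ss' => // lt_ss _.
have := gfinal_succ w le_s'; rewrite ts' addn0 => e.
have := lip s (s' - s); rewrite subnKC; last lia.
by case: fs => -> _; lia.
Qed.

End Greedy.

(** * Weighted path sums as a dynamic program *)

Section TutteTable.
Variables (lo hi : nat -> nat) (n : nat).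

Local Open Scope ring_scope.
Notation poly2 := {poly {poly int}}.

(* row k of the tables deals with the times n - k, ..., n *)
Fixpoint tabT (tgt k p : nat) : poly2 :=
  let t := (n - k)%N in let q := maxn p (lo t) in
  ('X - 1) ^+ (lo t - p) *
  if k is k'.+1 then
    tabT tgt k' q +
    (if (q < hi t)%N then tabT tgt k' q.+1 else ('X%:P - 1) * tabT tgt k' q)
  else (q == tgt)%:R.

(** Sums over paths that have still to touch: the first touch or block hands over to [tabT], and a
    path that never touches contributes 0. Before a touch [lo t < p], so no expiry factor occurs. *)
Fixpoint tabU (tgt k p : nat) : poly2 :=
  let t := (n - k)%N in
  if (p <= lo t)%N then tabT tgt k p else
  if k is k'.+1 then
    tabU tgt k' p +
    (if (p < hi t)%N then tabU tgt k' p.+1 else ('X%:P - 1) * tabT tgt k' p)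
  else 0.

Definition gweight t p w : poly2 :=
  ('X - 1) ^+ nexpired lo hi t p w * ('X%:P - 1) ^+ nblocked lo hi t p w.

Lemma sum_tuple_cons (F : seq bool -> poly2) k :
  \sum_(w : k.+1.-tuple bool) F w =
  \sum_(w : k.-tuple bool) (F (false :: w) + F (true :: w)).
Proof.
rewrite (reindex (fun bw : bool * k.-tuple bool => cons_tuple bw.1 bw.2)) /=; last first.
  exists (fun w : k.+1.-tuple bool => (thead w, behead_tuple w)) => [[b w]|w] _ /=.
    by congr pair; apply: val_inj.
  by rewrite [RHS]tuple_eta; apply: val_inj.
rewrite -(pair_bigA _ (fun b (w : k.-tuple bool) => F (b :: w))) /=.
by rewrite big_bool /= addrC -big_split.
Qed.

Lemma tabT_sum tgt k p : (k <= n)%N ->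
  tabT tgt k p =
  \sum_(w : k.-tuple bool | gfinal lo hi (n - k) p w == tgt) gweight (n - k) p w.
Proof.
rewrite big_mkcond /=.
elim: k p => [|k IH] p le_k.
  rewrite (eq_bigr (fun=> if maxn p (lo (n - 0)) == tgt
                          then ('X - 1) ^+ (lo (n - 0) - p) else 0)).
    rewrite sumr_const card_tuple expn0 mulr1n /=.
    by case: eqP; rewrite ?mulr1 ?mulr0.
  by move=> w _; rewrite (tuple0 w) /gweight /= addn0 expr0 mulr1.
rewrite (sum_tuple_cons (fun w => if gfinal lo hi (n - k.+1) p w == tgt
                            then gweight (n - k.+1) p w else 0)).
rewrite big_split /=.
have e : (n - k.+1).+1 = (n - k)%N by lia.
rewrite !e /gweight /= !e /gstep /=.
set t := (n - k.+1)%N; set q := maxn p (lo t).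
rewrite ?addn0 ?add0n mulrDr; congr (_ + _).
  rewrite IH ?(ltnW le_k) // mulr_sumr; apply: eq_bigr => w _.
  by case: ifP; rewrite ?mulr0 // /gweight exprD mulrA.
case: ltnP => /= [lt_q|le_q]; rewrite IH ?(ltnW le_k) //.
  rewrite ?add0n addn1 mulr_sumr; apply: eq_bigr => w _.
  by case: ifP; rewrite ?mulr0 // /gweight exprD mulrA.
rewrite addn0 !mulr_sumr; apply: eq_bigr => w _.
case: ifP; rewrite ?mulr0 // /gweight !exprD expr1 => _; ring.
Qed.

Lemma tabU_sum tgt k p : (k <= n)%N ->
  tabU tgt k p =
  \sum_(w : k.-tuple bool |
    touches lo hi (n - k) p w && (gfinal lo hi (n - k) p w == tgt))
    gweight (n - k) p w.
Proof.
elim: k p => [|k IH] p le_k.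
  rewrite /tabU; case: ifP => le_p.
    by rewrite tabT_sum //; apply: eq_bigl => w; rewrite (tuple0 w) /= le_p.
  by rewrite big1 // => w; rewrite (tuple0 w) /= le_p.
rewrite [LHS]/=; case: ifP => le_p.
  rewrite -[LHS]/(tabT tgt k.+1 p) tabT_sum //; apply: eq_bigl => w.
  by case: w => [[|b w] /= _]; rewrite le_p.
rewrite [RHS]big_mkcond /=.
rewrite (sum_tuple_cons (fun w => if touches lo hi (n - k.+1) p w &&
     (gfinal lo hi (n - k.+1) p w == tgt) then gweight (n - k.+1) p w else 0)).
rewrite big_split /=.
have e : (n - k.+1).+1 = (n - k)%N by lia.
rewrite !e le_p /gweight /= !e /gstep /=.
set t := (n - k.+1)%N in le_p *; have -> : maxn p (lo t) = p by lia.
have -> : (lo t - p = 0)%N by lia.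
rewrite ?addn0 ?add0n; congr (_ + _); first by rewrite IH ?(ltnW le_k) // big_mkcond.
case: ltnP => /= [lt_q|le_q].
  by rewrite IH ?(ltnW le_k) // ?add0n addn1 big_mkcond.
rewrite addn0 tabT_sum ?(ltnW le_k) // mulr_sumr big_mkcond.
apply: eq_bigr => w _; case: ifP => // _; rewrite /gweight !exprD expr0 expr1; ring.
Qed.

(** Peeling off one expiry at a time replaces a power of x - 1 by a single factor, so that an entry
    costs a bounded number of operations. *)
Lemma tabT_expire tgt k p : (p < lo (n - k))%N ->
  tabT tgt k p = ('X - 1) * tabT tgt k p.+1.
Proof.
move=> lt_p.
have e : (lo (n - k) - p = (lo (n - k) - p.+1).+1)%N by lia.
have e' : maxn p (lo (n - k)) = maxn p.+1 (lo (n - k)) by lia.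
by case: k lt_p e e' => [|k] /= lt_p e e'; rewrite e e' exprS mulrA.
Qed.

Lemma tabT0 tgt p : (lo n <= p)%N -> tabT tgt 0 p = (p == tgt)%:R.
Proof.
move=> le_p; rewrite /= subn0; have -> : maxn p (lo n) = p by lia.
have -> : (lo n - p = 0)%N by lia.
rewrite expr0 mul1r; reflexivity.
Qed.

Lemma tabTS tgt k p : (lo (n - k.+1) <= p)%N ->
  tabT tgt k.+1 p = tabT tgt k p +
    (if (p < hi (n - k.+1))%N then tabT tgt k p.+1
     else ('X%:P - 1) * tabT tgt k p).
Proof.
move=> le_p /=; set t := (n - k.+1)%N in le_p *; have -> : maxn p (lo t) = p by lia.
have -> : (lo t - p = 0)%N by lia.
rewrite expr0 mul1r; reflexivity.
Qed.

End TutteTable.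

(** * Optimality of the greedy matching *)

Section Koenig.
Variables (lo hi : nat -> nat) (m W : nat) (w : seq bool) (s : nat).
Local Notation n := (size w).

Hypothesis lo_mono : {homo lo : t u / t <= u}.
Hypothesis hi_mono : {homo hi : t u / t <= u}.
Hypothesis lo_n : lo n = m.
Hypothesis hi_bounds : forall t, W <= hi t <= W + m.
Hypothesis W_le_m : W <= m.
Hypothesis s_le_W : s <= W.
Hypothesis s_fixed : gfinal lo hi 0 s w = s + m.

(** The pointer before the expiries of time t; [gptr t] is the pointer after them, when the element
    of time t is examined. *)
Fixpoint gpath t : nat :=
  if t is t'.+1 then gstep lo hi t' (gpath t') (nth false w t') else s.

Definition gptr t := maxn (gpath t) (lo t).
Definition matched t := nth false w t && (gptr t < hi t).
Definition blocked t := nth false w t && (hi t <= gptr t).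

Lemma gpathS t : gpath t.+1 = gptr t + matched t.
Proof. by []. Qed.

(** The second half says that each element before t is matched or blocked, written without
    subtraction. *)
Lemma gpath_drop t : t <= n ->
  gfinal lo hi t (gpath t) (drop t w) = s + m /\
  \sum_(i < t) matched i + nblocked lo hi 0 s w + count id (drop t w) =
  count id w + nblocked lo hi t (gpath t) (drop t w).
Proof.
elim: t => [|t IH] le_t; first by rewrite drop0 big_ord0 s_fixed /=; split; lia.
have [] := IH (ltnW le_t).
rewrite (drop_nth false) //= => -> e; split => //.
move: e; rewrite big_ord_recr /= -/(matched t) /=.
rewrite -[maxn _ _]/(gptr t) /matched.
by rewrite [hi t <= _]leqNgt; case: nth; case: (gptr t < hi t) => /=; lia.
Qed.

Lemma gpath_end : gptr n = s + m.
Proof. by have [] := gpath_drop (leqnn n); rewrite drop_size. Qed.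

Lemma sum_matched :
  \sum_(i < n) matched i = count id w - nblocked lo hi 0 s w.
Proof. by have [_] := gpath_drop (leqnn n); rewrite drop_size /=; lia. Qed.

Lemma gpath_mono : {homo gpath : t u / t <= u}.
Proof.
apply: homo_leq => //; first by move=> ? ? ?; apply: leq_trans.
by move=> t; rewrite gpathS /gptr; lia.
Qed.

Lemma gpath_le_gptr t : gpath t <= gptr t.
Proof. exact: leq_maxl. Qed.

Lemma gptr_le_gpath t u : t < u -> gptr t <= gpath u.
Proof. by move=> /gpath_mono; rewrite gpathS; lia. Qed.

Lemma gpath_le t : t <= n -> gpath t <= s + m.
Proof. by move=> /gpath_mono; have := gpath_end; rewrite /gptr; lia. Qed.

(** The pointer climbs from s to s + m, so it either jumps over k in an expiry or steps off k in a
    match. *)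
Lemma passed_cases k : s <= k < s + m ->
  (exists2 u, u <= n & gpath u <= k < lo u) \/
  (exists2 u, u < n & matched u /\ gptr u = k).
Proof.
move=> /andP[le_s lt_k].
have [le_n|lt_n] := leqP (gpath n) k.
  left; exists n => //; have := gpath_end; rewrite /gptr; lia.
have : forall u, u <= n -> k < gpath u ->
  (exists2 u, u <= n & gpath u <= k < lo u) \/
  (exists2 u, u < n & matched u /\ gptr u = k); last by move/(_ n); apply.
elim=> [|u IH] le_u lt_u; first by move: lt_u => /=; lia.
have [lt_u'|le_k] := ltnP k (gpath u); first by apply: IH; first exact: ltnW.
have [lt_lo|le_lo] := ltnP k (lo u).
  by left; exists u; rewrite ?le_k // ltnW.
right; exists u => //; move: lt_u; rewrite gpathS /gptr.
by case: matched => /= ?; split => //; lia.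
Qed.

(* label k is the kind of the next event at or after time n - k: true for an
   expiry, false for a blocked element, and c0 if there is none. *)
Fixpoint label c0 k : bool :=
  let t := n - k in
  if gpath t < lo t then true else
  if k is k'.+1 then (if blocked t then false else label c0 k') else c0.

(** After time n the scan resumes at time 0, so the seed must agree with the label at time 0. If a
    turn has no event at all, this choice makes every label true. *)
Definition cyclabel := label true n.

(** As a function of its seed a label is either constant or the identity; in both cases the label of
    a full turn is a fixed point. *)
Lemma label_fixed : label cyclabel n = cyclabel.
Proof.
have h k : label true k = label false k \/ (forall c, label c k = c).
  elim: k => [|k IH] /=; first by case: ifP; [left|right].
  by case: ifP => // _; [left|case: ifP => // _; left].
rewrite /cyclabel; have [e|e] := h n; last by rewrite !e.
by case E: (label true n); rewrite // -e.
Qed.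

Definition next_event t := label cyclabel (n - t).
(** The expiries of time t precede its element, so the label of the element itself skips them. *)
Definition next_event_strict t :=
  if blocked t then false else next_event t.+1.

Lemma next_event0 : next_event 0 = cyclabel.
Proof. by rewrite /next_event subn0 label_fixed. Qed.

Lemma next_event_n : next_event n = (gpath n < lo n) || cyclabel.
Proof. by rewrite /next_event subnn /= subn0; case: ifP. Qed.

Lemma next_eventE t : t < n ->
  next_event t = (gpath t < lo t) || next_event_strict t.
Proof.
move=> lt_t; rewrite /next_event_strict /next_event.
have -> : n - t = (n - t.+1).+1 by lia.
by rewrite /=; have -> : n - (n - t.+1).+1 = t by lia; case: ifP.
Qed.

(** An expiry must occur at some v in [t, u), and then [gpath t <= gpath v < lo v <= lo u]. *)
Lemma event_expiry t u : t <= u <= n -> next_event t -> ~~ next_event u ->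
  gpath t < lo u.
Proof.
move=> /andP[le_tu le_u]; move: le_tu.
have [d e] : exists d, d = u - t by eexists.
elim: d t e => [|d IH] t e le_t ct cu.
  have e' : t = u by lia.
  by case/negP: cu; rewrite -e'.
have lt_t : t < n by lia.
move: ct; rewrite next_eventE // => /orP[lt_lo|].
  exact: leq_trans lt_lo (lo_mono le_t).
rewrite /next_event_strict; case: ifP => // _ ct.
have /IH -/(_ _ ct cu) h : d = u - t.+1 by lia.
by apply: leq_ltn_trans (gpath_mono (leqnSn t)) _; apply: h; lia.
Qed.

Lemma event_expiry_strict t u :
  t <= u < n -> next_event t -> ~~ next_event_strict u -> gpath t < lo u.
Proof.
move=> /andP[le_tu lt_u] ct cu.
have [h|h] := boolP (next_event u); last by apply: event_expiry => //; lia.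
move: h; rewrite next_eventE // (negbTE cu) orbF.
by apply: leq_ltn_trans; apply: gpath_mono.
Qed.

(** Dually a block occurs at some v in [t, u), and then [hi t <= hi v <= gptr v <= gpath u]. *)
Lemma event_block t u : t <= u <= n -> ~~ next_event t -> next_event u ->
  hi t <= gpath u.
Proof.
move=> /andP[le_tu le_u]; move: le_tu.
have [d e] : exists d, d = u - t by eexists.
elim: d t e => [|d IH] t e le_t ct cu.
  have e' : t = u by lia.
  by case/negP: ct; rewrite e'.
have lt_t : t < n by lia.
move: ct; rewrite next_eventE // negb_or => /andP[_].
rewrite /next_event_strict; case: ifP => [/andP[_ le_hi] _|_ ct].
  by apply: leq_trans le_hi _; apply: gptr_le_gpath; lia.
have /IH -/(_ _ ct cu) h : d = u - t.+1 by lia.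
by apply: leq_trans (hi_mono (leqnSn t)) _; apply: h; lia.
Qed.

Lemma event_block_strict t u :
  t < u <= n -> ~~ next_event_strict t -> next_event u -> hi t <= gpath u.
Proof.
move=> /andP[lt_tu le_u]; rewrite /next_event_strict.
case: ifP => [/andP[_ le_hi] _ _|_ ct cu].
  by apply: leq_trans le_hi _; apply: gptr_le_gpath.
by apply: leq_trans (hi_mono (leqnSn t)) _; apply: event_block; rewrite ?lt_tu.
Qed.

Definition gclass t := if gptr t < m then gptr t else gptr t - m.

(** The copies of class q within reach are q and q + m. The second needs no lower bound, because
    [lo t <= m] up to time n. *)
Definition gadj t q := (lo t <= q < hi t) || (q + m < hi t).

Lemma matched_bounds t : t < n -> matched t -> s <= gptr t < s + m.
Proof.
move=> lt_t mt; have := gpath_le lt_t; rewrite gpathS mt.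
have := gpath_mono (leq0n t); have := gpath_le_gptr t; rewrite /=; lia.
Qed.

Lemma matched_class t : t < n -> matched t ->
  gclass t < m /\ gadj t (gclass t).
Proof.
move=> lt_t mt; have := matched_bounds lt_t mt.
have : lo t <= gptr t by apply: leq_maxr.
move: mt => /andP[_ lt_hi]; rewrite /gclass /gadj.
by case: (ltnP (gptr t) m) => ?; split; lia.
Qed.

Lemma gclass_inj t u : t < n -> u < n -> matched t -> matched u ->
  gclass t = gclass u -> t = u.
Proof.
wlog lt_tu : t u / t < u => [wl|].
  case: (ltngtP t u) => // lt ? ? ? ? e; first exact: wl.
  by apply/esym/wl => //; apply/esym.
move=> lt_t lt_u mt mu; rewrite /gclass.
have := matched_bounds lt_t mt; have := matched_bounds lt_u mu.
have := gpath_mono lt_tu; rewrite gpathS mt; have := gpath_le_gptr u.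
by case: (ltnP (gptr t) m) => ?; case: (ltnP (gptr u) m) => ?; lia.
Qed.

Lemma matched_strict u : matched u -> next_event_strict u = next_event u.+1.
Proof.
rewrite /next_event_strict /blocked /matched => /andP[_].
by rewrite ltnNge andbC => /negbTE ->.
Qed.

(* Elements with next_event_strict, together with the classes of the other
   matched elements, form a vertex cover. *)
Lemma greedy_cover t q : t < n -> q < m -> gadj t q -> ~~ next_event_strict t ->
  exists2 u, u < n & [/\ matched u, ~~ next_event_strict u & gclass u = q].
Proof.
move=> lt_t lt_q adj ct.
have [k kE /andP[le_k lt_k]] :
    exists2 k, k = q \/ k = q + m & lo t <= k < hi t.
  move/orP: adj => [?|?]; first by exists q; [left|].
  exists (q + m); first by right.
  by have := lo_mono (ltnW lt_t); lia.
have matched_event u : u < n -> next_event_strict u -> next_event u.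
  by move=> lt_u cu; rewrite next_eventE // cu orbT.
(* The copy k lies below, inside or above the window [s, s + m). Outside it, the path passes the
   copy one turn later or earlier, and [cyclabel] carries the label across the cut. In each case the
   passed copy cannot expire, and the element matched to it cannot have label true. *)
have [lt_ks|le_sk] := ltnP k s.
  have {}kE : k = q by lia.
  have [|[u le_u lt_u]|[u lt_u [mu uE]]] := @passed_cases (k + m); first lia.
    by have := lo_mono le_u; lia.
  exists u => //; split; rewrite // /gclass ?uE; last by case: ltnP; lia.
  apply/negP; rewrite matched_strict // => cu.
  have gu : gpath u.+1 = (k + m).+1 by rewrite gpathS mu uE addn1.
  (* After u the pointer exceeds m = [lo n], so no expiry follows; a label true would persist to
     time n and, across the cut, to time 0, forcing s < [lo t] <= k. *)
  have cn : next_event n.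
    apply/negP => /negP cn; have := @event_expiry u.+1 n; rewrite gu lo_n.
    by rewrite lt_u leqnn cu cn => /(_ isT isT isT); lia.
  have := event_expiry_strict (t := 0) lt_t _ ct => /=.
  rewrite next_event0; move: cn; rewrite next_event_n lo_n.
  by have := gpath_mono lt_u; rewrite gu; case: cyclabel => // ? ?; [move/(_ isT)|]; lia.
have [lt_km|le_mk] := ltnP k (s + m).
  have [|[u le_u lt_u]|[u lt_u [mu uE]]] := @passed_cases k; first lia.
    have lt_tu : t < u by rewrite ltnNge; apply/negP => /lo_mono; lia.
    have : next_event u.
      case: (ltngtP u n) le_u lt_u => // [lt_n _|-> _] lt_u.
        by rewrite next_eventE //; apply/orP; left; lia.
      by rewrite next_event_n; apply/orP; left; lia.
    by move/(event_block_strict _ ct); rewrite lt_tu le_u => /(_ isT); lia.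
  exists u => //; split; rewrite // /gclass ?uE; last by case: ltnP; lia.
  apply/negP => cu.
  case: (ltngtP t u) => [lt_tu|lt_ut|e]; last by case/negP: ct; rewrite e.
    have := event_block_strict (u := u) _ ct (matched_event _ lt_u cu).
    by rewrite lt_tu (ltnW lt_u) => /(_ isT); have := gpath_le_gptr u; lia.
  move: cu; rewrite matched_strict // => cu.
  have := event_expiry_strict (t := u.+1) _ cu ct; rewrite lt_ut lt_t => /(_ isT).
  by rewrite gpathS mu uE; lia.
have {}kE : k = q + m by lia.
have ltW : q < hi 0 by have := hi_bounds t; have := hi_bounds 0; lia.
(* A label true at time 0 is also one at time n; a block between t and n would then lift the pointer
   to [hi t], above s + m. *)
have c0 : ~~ next_event 0.
  rewrite next_event0; apply/negP => c0.
  have := event_block_strict (u := n) _ ct; rewrite lt_t leqnn next_event_n c0 orbT.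
  by move=> /(_ isT isT); have := gpath_le (leqnn n); lia.
have [|[u le_u lt_u]|[u lt_u [mu uE]]] := @passed_cases q; first lia.
  have : next_event u.
    case: (ltngtP u n) le_u lt_u => // [lt_n _|-> _] lt_u.
      by rewrite next_eventE //; apply/orP; left; lia.
    by rewrite next_event_n; apply/orP; left; lia.
  by move/(event_block (t := 0) _ c0); rewrite le_u => /(_ isT); lia.
exists u => //; split; rewrite // /gclass ?uE; last by case: ltnP; lia.
apply/negP => cu; have := event_block (t := 0) (u := u) _ c0 (matched_event _ lt_u cu).
by rewrite (ltnW lt_u) => /(_ isT); have := gpath_le_gptr u; lia.
Qed.

(** Blocked elements are labelled false, so every vertex of the cover is met by the matching. *)
Lemma covered_matched t : nth false w t -> next_event_strict t -> matched t.
Proof.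
rewrite /next_event_strict /blocked /matched => -> /=.
by case: leqP.
Qed.

End Koenig.

(** * Cyclic intervals *)

Section CutIntervals.
Variables (m : nat) (F L : 'I_m -> nat).

Definition wraps j := L j < F j.

Definition in_cut t j :=
  if wraps j then (F j <= t) || (t <= L j) else F j <= t <= L j.

Definition lo_count t := \sum_j (L j < t).
(** Wrapping intervals are open at time 0 and have the lowest numbers; each is counted again, as its
    copy one turn later, when its first element is reached. *)
Definition hi_count t := \sum_j (wraps j + (F j <= t)).
Definition nwraps := \sum_j wraps j.
Definition last_rank j := lo_count (L j).

Lemma ltn_sum_nat (P Q : 'I_m -> nat) i0 :
  (forall i, P i <= Q i) -> P i0 < Q i0 -> \sum_i P i < \sum_i Q i.
Proof.
move=> le_PQ lt_i0; rewrite (bigD1 i0) // [X in _ < X](bigD1 i0) //= -addSn.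
by apply: leq_add => //; apply: leq_sum => i _; apply: le_PQ.
Qed.

Lemma lo_count_mono : {homo lo_count : t u / t <= u}.
Proof. by move=> t u le_tu; apply: leq_sum => j _; lia. Qed.

Lemma hi_count_mono : {homo hi_count : t u / t <= u}.
Proof. by move=> t u le_tu; apply: leq_sum => j _; lia. Qed.

Lemma lo_le_hi_count t : lo_count t <= hi_count t.
Proof. by apply: leq_sum => j _; rewrite /wraps; lia. Qed.

Lemma lo_count0 : lo_count 0 = 0.
Proof. exact: big1. Qed.

Lemma hi_countE t : hi_count t = nwraps + \sum_j (F j <= t).
Proof. exact: big_split. Qed.

Lemma sum_bool_le (P : pred 'I_m) : \sum_j P j <= m.
Proof.
rewrite -[X in _ <= X]card_ord -sum1_card; apply: leq_sum => j _.
by case: (P j).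
Qed.

Lemma nwraps_le : nwraps <= m. Proof. exact: sum_bool_le. Qed.

Lemma hi_count_bounds t : nwraps <= hi_count t <= nwraps + m.
Proof. by rewrite hi_countE leq_addr leq_add2l sum_bool_le. Qed.

Lemma lo_count_all n : (forall j, L j < n) -> lo_count n = m.
Proof.
move=> lt_L; rewrite -[RHS]card_ord -sum1_card; apply: eq_bigr => j _.
by rewrite lt_L.
Qed.

Hypothesis in_cut_antichain :
  forall i j, i != j -> exists2 t, in_cut t i & ~~ in_cut t j.

(** The two witnesses of incomparability settle every case. Among intervals of the same kind the
    orders agree; a wrapping interval precedes the others by last element and follows them by first
    element. *)
Lemma cut_order i j : i != j ->
  [/\ L i != L j, F i != F j,
      wraps i = wraps j -> (L i < L j) = (F i < F j),
      wraps i -> ~~ wraps j -> (L i < L j) && (F j < F i)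
    & ~~ wraps i -> wraps j -> (L j < L i) && (F i < F j)].
Proof.
move=> neq_ij; have [t] := in_cut_antichain neq_ij.
rewrite eq_sym in neq_ij; have [u] := in_cut_antichain neq_ij.
rewrite /in_cut /wraps.
by case: (ltnP (L i) (F i)) => ?; case: (ltnP (L j) (F j)) => *; split; lia.
Qed.

Lemma first_pos_inj : injective F.
Proof.
move=> i j e; apply/eqP; apply/negPn/negP => /cut_order[_].
by rewrite e eqxx.
Qed.

Lemma last_rank_lt j : last_rank j < m.
Proof.
apply: (@leq_trans (\sum_(i < m) 1)); last by rewrite sum1_card card_ord.
by apply: (@ltn_sum_nat _ _ j) => [i|]; rewrite ?ltnn //; case: (_ < _).
Qed.

Lemma lo_count_last_rank t j : (lo_count t <= last_rank j) = (t <= L j).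
Proof.
apply/idP/idP => [|/lo_count_mono //]; apply: contraTT; rewrite -!ltnNge => lt_t.
by apply: (@ltn_sum_nat _ _ j) => [i|]; lia.
Qed.

Lemma last_rank_inj : injective last_rank.
Proof.
move=> i j e; apply/eqP; apply/negPn/negP => /cut_order[+ _ _ _ _].
have := lo_count_last_rank (L i) j; have := lo_count_last_rank (L j) i.
by rewrite -/(last_rank i) -/(last_rank j) e leqnn; lia.
Qed.

Lemma first_count_le t j :
  (\sum_i (F i < F j) < \sum_i (F i <= t)) = (F j <= t).
Proof.
apply/idP/idP => [|le_t]; last by apply: (@ltn_sum_nat _ _ j) => [i|]; lia.
by apply: contraTT; rewrite -!ltnNge ltnS => lt_t; apply: leq_sum => i _; lia.
Qed.

(* Cut open, the classes unroll to the integers: class q reappears as q + m,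
   and the pointers active at time t are those in [lo, hi). *)
Lemma in_cut_adj t j :
  in_cut t j = gadj lo_count hi_count m t (last_rank j).
Proof.
rewrite /in_cut /gadj lo_count_last_rank; case: ifPn => wj.
  (* The number of the second copy, counted by openings instead of endings; [cut_order] matches the
     two counts term by term. *)
  have e : last_rank j + m = nwraps + \sum_i (F i < F j).
    rewrite -{1}[m]card_ord -sum1_card -!big_split /=; apply: eq_bigr => i _.
    have [->|/cut_order[]] := eqVneq i j; first by rewrite !ltnn wj.
    by rewrite wj; case: (wraps i) => /=; lia.
  have lt_W : last_rank j < nwraps.
    apply: (@ltn_sum_nat _ _ j) => [i|]; last by rewrite ltnn wj.
    have [->|/cut_order[]] := eqVneq i j; first by rewrite ltnn.
    by rewrite wj; case: (wraps i) => /=; lia.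
  rewrite e hi_countE ltn_add2l first_count_le orbC; congr (_ || _).
  by have := hi_count_bounds t; rewrite hi_countE; lia.
have e : last_rank j = nwraps + \sum_i (F i < F j).
  rewrite -big_split /=; apply: eq_bigr => i _.
  have [->|/cut_order[]] := eqVneq i j; first by rewrite !ltnn (negbTE wj).
  by rewrite (negbTE wj); case: (wraps i) => /=; lia.
have -> : (last_rank j + m < hi_count t) = false.
  by have := hi_count_bounds t; rewrite e; lia.
by rewrite orbF andbC e hi_countE ltn_add2l first_count_le.
Qed.

End CutIntervals.

(** Trades the index set and its dependent function for a map from elements to indices. Values in
    [option J] keep this map total even when J is empty. *)
Lemma partial_transversalP (S J : finType) (A : J -> {set S}) (X : {set S}) :
  reflect (exists2 phi : S -> option J, {in X &, injective phi} &
             forall x, x \in X -> exists2 j, phi x = Some j & x \in A j)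
          (partial_transversal A X).
Proof.
apply: (iffP existsP) => [[K /existsP[x /and3P[/injectiveP x_inj /forallP xA /eqP ->]]]|].
  pose phi s := omap val [pick k | x k == s].
  have phiE k : phi (x k) = Some (val k).
    by rewrite /phi; case: pickP => [k' /eqP/x_inj -> //|/(_ k)]; rewrite eqxx.
  exists phi => [_ _ /imsetP[k _ ->] /imsetP[k' _ ->]|_ /imsetP[k _ ->]].
    by rewrite !phiE => -[/val_inj ->].
  by exists (val k).
case=> phi phi_inj phiA.
pose K := [set j | Some j \in phi @: X].
have exK (k : {k | k \in K}) : exists y, (y \in X) && (phi y == Some (val k)).
  have := valP k; rewrite inE => /imsetP[y yX ->].
  by exists y; rewrite yX eqxx.
pose x := [ffun k => xchoose (exK k)].
have xP k : (x k \in X) && (phi (x k) == Some (val k)).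
  by rewrite ffunE; exact: (xchooseP (exK k)).
exists K; apply/existsP; exists x; apply/and3P; split.
- apply/injectiveP => k k' e; apply: val_inj.
  have /andP[_ /eqP] := xP k; have /andP[_ /eqP] := xP k'.
  by rewrite e => -> [].
- apply/forallP => k; have /andP[kX /eqP ek] := xP k.
  by have [j] := phiA _ kX; rewrite ek => -[<-].
apply/eqP/setP => y; apply/idP/imsetP => [yX|[k _ ->]]; last by have /andP[] := xP k.
have [j ej _] := phiA _ yX.
have jK : j \in K by rewrite inE -ej imset_f.
exists (Sub j jK) => //; have /andP[xX /eqP] := xP (Sub j jK).
by rewrite /= -ej => /(phi_inj _ _ xX yX).
Qed.

(** * Positions on the cut cycle *)

Section CyclicPositions.
Variables (S : finType) (sigma : {perm S}).
Hypothesis sigma_cyclic : cyclic_perm sigma.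
Local Notation n := #|S|.

(* The cycle is cut before the element with code 0; the argument is only a
   witness that S is not empty. *)
Definition first_elt (x : S) := nth x (enum S) 0.

Lemma first_eltE x y : first_elt x = first_elt y.
Proof.
apply: set_nth_default; rewrite -cardE; apply/card_gt0P; by exists x.
Qed.

Definition pos x := findex sigma (first_elt x) x.
Definition elt (i : 'I_n) := iter i sigma (first_elt (enum_val i)).

Lemma fconnect_cyclic x y : fconnect sigma x y.
Proof.
have /porbitP[i ->] := sigma_cyclic x y.
by rewrite permX fconnect_iter.
Qed.

Lemma order_cyclic x : fingraph.order sigma x = n.
Proof. by apply: eq_card => y; rewrite !inE fconnect_cyclic. Qed.

Lemma pos_lt x : pos x < n.
Proof. by rewrite -(order_cyclic (first_elt x)) findex_max // fconnect_cyclic. Qed.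

Lemma iter_pos x y : iter (pos x) sigma (first_elt y) = x.
Proof. by rewrite (first_eltE y x) iter_findex // fconnect_cyclic. Qed.

Definition pos_ord x := Ordinal (pos_lt x).

Lemma pos_ordK : cancel pos_ord elt.
Proof. by move=> x; rewrite /elt iter_pos. Qed.

Lemma pos_elt i : pos (elt i) = i.
Proof.
rewrite /pos (first_eltE _ (enum_val i)) findex_iter // order_cyclic.
exact: ltn_ord.
Qed.

Lemma eltK : cancel elt pos_ord.
Proof. by move=> i; apply: val_inj; rewrite /= pos_elt. Qed.

Lemma pos_inj : injective pos.
Proof. by move=> x y e; rewrite -(pos_ordK x) -(pos_ordK y); congr elt; apply: val_inj. Qed.

Lemma findex_pos x y :
  findex sigma x y = if pos x <= pos y then pos y - pos x else pos y + n - pos x.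
Proof.
have := pos_lt x; have := pos_lt y.
set d := (if _ then _ else _) => lt_y lt_x.
have lt_d : d < n by rewrite /d; case: (leqP (pos x) (pos y)) => ?; lia.
have -> : y = iter d sigma x.
  rewrite -[x in RHS](iter_pos x x) -iterD /d; case: (leqP (pos x) (pos y)) => [le_xy|lt_yx].
    by rewrite subnK // iter_pos.
  rewrite subnK; last by apply: leq_trans (ltnW lt_x) _; rewrite leq_addl.
  by rewrite iterD -(order_cyclic (first_elt x)) iter_order ?iter_pos //; apply: perm_inj.
by rewrite findex_iter // order_cyclic.
Qed.

(** Membership compares the distances from f to x and to l along the cycle; either walk may cross
    the cut. *)
Lemma mem_sigma_interval f l x :
  (x \in sigma_interval sigma f l) =
  if pos l < pos f then (pos f <= pos x) || (pos x <= pos l)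
  else pos f <= pos x <= pos l.
Proof.
have -> : (x \in sigma_interval sigma f l) =
          (findex sigma f x <= findex sigma f l).
  rewrite inE; apply/trajectP/idP => [[i lt_i ->]|le_x].
    rewrite findex_iter // order_cyclic.
    by have := findex_max (fconnect_cyclic f l); rewrite order_cyclic; lia.
  by exists (findex sigma f x); rewrite ?ltnS // iter_findex // fconnect_cyclic.
have := pos_lt x; have := pos_lt f; have := pos_lt l; rewrite !findex_pos.
by case: (leqP (pos f) (pos x)) => ?; case: (leqP (pos f) (pos l)) => ?; lia.
Qed.

Lemma sum_pos (G : nat -> nat) : \sum_(x : S) G (pos x) = \sum_(i < n) G i.
Proof.
rewrite (reindex elt); last by exists pos_ord => x _; [apply: eltK|apply: pos_ordK].
by apply: eq_bigr => i _; rewrite pos_elt.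
Qed.

Definition set_of_bits (w : seq bool) : {set S} := [set x | nth false w (pos x)].

Lemma card_set_of_bits (w : n.-tuple bool) : #|set_of_bits w| = count id w.
Proof.
rewrite -sum1_card big_mkcond /=.
transitivity (\sum_(x : S) nth false w (pos x) : nat).
  by apply: eq_bigr => x _; rewrite inE; case: nth.
rewrite (sum_pos (fun i => nat_of_bool (nth false w i))) -sum1_count.
rewrite (big_nth false) size_tuple big_mkord [RHS]big_mkcond /=.
by apply: eq_bigr => i _; case: nth.
Qed.

Lemma sum_set_of_bits (V : nmodType) (G : {set S} -> V) :
  (\sum_(A : {set S}) G A = \sum_(w : n.-tuple bool) G (set_of_bits w))%R.
Proof.
rewrite (reindex (fun w : n.-tuple bool => set_of_bits w)) //.
exists (fun A : {set S} => [tuple elt i \in A | i < n]) => [w|A] _.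
  apply: eq_from_tnth => i; rewrite tnth_mktuple inE pos_elt.
  by rewrite (tnth_nth false).
apply/setP => x; rewrite inE -[pos x]/(val (pos_ord x)) -tnth_nth.
by rewrite tnth_mktuple pos_ordK.
Qed.

End CyclicPositions.

(** * The Tutte polynomial *)

Section MultiPath.
Variables (S : finType) (sigma : {perm S}) (m : nat) (f l : 'I_m -> S).
Hypothesis sigma_cyclic : cyclic_perm sigma.
Let A (j : 'I_m) := sigma_interval sigma (f j) (l j).
Hypothesis A_antichain : antichain A.
Local Notation n := #|S|.
Let F j := pos sigma (f j).
Let L j := pos sigma (l j).
Let lo := lo_count L.
Let hi := hi_count F L.
Local Notation pos := (pos sigma).
Let M := transversal_matroid A.

Lemma mem_A_in_cut x j : (x \in A j) = in_cut F L (pos x) j.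
Proof. exact: mem_sigma_interval. Qed.

Lemma cut_antichain i j : i != j -> exists2 t, in_cut F L t i & ~~ in_cut F L t j.
Proof.
move=> /A_antichain/subsetPn[x]; rewrite !mem_A_in_cut.
by exists (pos x).
Qed.

Lemma mem_A_adj x j : (x \in A j) = gadj lo hi m (pos x) (last_rank L j).
Proof. by rewrite mem_A_in_cut (in_cut_adj cut_antichain). Qed.

(** Distinct members of the antichain have distinct first elements. *)
Lemma leq_nintervals : m <= n.
Proof.
have F_lt j : F j < n by apply: pos_lt.
rewrite -[m]card_ord -[n]card_ord.
apply: (@leq_card _ _ (fun j => Ordinal (F_lt j))) => i j [/eqP].
by rewrite -/(F i) => /eqP/(first_pos_inj cut_antichain).
Qed.

Lemma lo_end : lo n = m.
Proof. by apply: lo_count_all => j; apply: pos_lt. Qed.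

(** * Rank of a subset from its greedy scan *)

Section Rank.
Variables (w : n.-tuple bool) (s : nat).
Hypothesis s_le : s <= hi 0.
Hypothesis s_fixed : gfinal lo hi 0 s w = s + m.

Let lo_size : lo (size w) = m.
Proof. by rewrite size_tuple lo_end. Qed.

(** The path ends at most at [hi n], which is at most [nwraps] + m, and it gains exactly m. *)
Let s_le_W : s <= nwraps F L.
Proof.
have := gfinal_le (lo_le_hi_count F L) (fun t => @hi_count_mono _ F L _ _ (leqnSn t)) w s_le.
rewrite s_fixed add0n size_tuple.
have /andP[_] := hi_count_bounds F L n; lia.
Qed.

Let nu t := matched lo hi w s t.
Let ce t := next_event_strict lo hi w s t.
Let X := [set x | nu (pos x)].

Let X_sub : X \subset set_of_bits sigma w.
Proof. by apply/subsetP => x; rewrite !inE => /andP[]. Qed.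

Let card_X : #|X| = count id w - nblocked lo hi 0 s w.
Proof.
rewrite -(sum_matched lo_size (nwraps_le F L) s_le_W s_fixed) size_tuple.
rewrite -sum1_card big_mkcond /=.
rewrite -(sum_pos sigma_cyclic (fun i => nat_of_bool (nu i))).
by apply: eq_bigr => x _; rewrite inE; case: nu.
Qed.

Let class_pos x := gclass lo hi m w s (pos x).

Let pos_size x : pos x < size w.
Proof. by rewrite size_tuple pos_lt. Qed.

Let class_inj : {in X &, injective class_pos}.
Proof.
move=> x y; rewrite !inE => mx my e; apply: (pos_inj sigma_cyclic).
exact: (gclass_inj lo_size (nwraps_le F L) s_le_W s_fixed).
Qed.

(** An injection of ['I_m] into itself is onto. *)
Let class_ex q : q < m -> exists j, last_rank L j = q.
Proof.
move=> lt_q; pose r (j : 'I_m) := Ordinal (last_rank_lt L j).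
have r_inj : injective r by move=> i j [/(last_rank_inj cut_antichain)].
have [g _ gK] := injF_bij r_inj.
by exists (g (Ordinal lt_q)); have [] := congr1 val (gK (Ordinal lt_q)).
Qed.

Let X_indep : X \in M.
Proof.
rewrite inE; apply/partial_transversalP.
pose phi x := [pick j | last_rank L j == class_pos x].
have phiE x : x \in X -> exists j, [/\ phi x = Some j,
    last_rank L j = class_pos x & x \in A j].
  rewrite inE => mx.
  have [lt_m adj] :=
    matched_class lo_size (nwraps_le F L) s_le_W s_fixed (pos_size x) mx.
  have [j ej] := class_ex lt_m.
  rewrite /phi; case: pickP => [j' /eqP ej'|/(_ j)]; last by rewrite ej eqxx.
  by exists j'; rewrite mem_A_adj ej'.
exists phi => [x y xX yX|x /phiE[j [-> _ xj]]]; last by exists j.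
have [i [-> ei _]] := phiE _ xX; have [j [-> ej _]] := phiE _ yX.
by move=> [e]; apply: class_inj; rewrite // -ei -ej e.
Qed.

(** Koenig duality as an injection g of I into the matched set: an element of the cover stays put,
    any other goes to the matched element holding the class of its own interval. Labels are
    preserved, so the two kinds of images never meet. *)
Let indep_le I : I \in M -> I \subset set_of_bits sigma w -> #|I| <= #|X|.
Proof.
rewrite inE => /partial_transversalP[phi phi_inj phiA] /subsetP sub_I.
pose q x := if phi x is Some j then last_rank L j else 0.
(* The default value x never occurs on I, by [greedy_cover]. *)
pose g x := if ce (pos x) then x else
  odflt x [pick y | [&& nu (pos y), ~~ ce (pos y) & class_pos y == q x]].
have gP x : x \in I -> [/\ g x \in X, ce (pos (g x)) = ce (pos x)
    & ce (pos x) = false -> class_pos (g x) = q x].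
  move=> xI; have := sub_I x xI; rewrite inE => wx; rewrite /g.
  case cx: (ce (pos x)); first by split; rewrite // inE; apply: covered_matched.
  case: pickP => [y /and3P[ny cy /eqP ey]|no].
    by split; rewrite //= ?inE // (negbTE cy).
  have [j ej xj] := phiA x xI; move: xj; rewrite mem_A_adj => adj.
  have [|u lt_u [nuu cu eu]] := greedy_cover (@lo_count_mono _ L)
    (@hi_count_mono _ F L) lo_size (hi_count_bounds F L) (nwraps_le F L) s_le_W
    s_fixed (pos_size x) (last_rank_lt L j) adj; first by rewrite -/(ce _) cx.
  rewrite size_tuple in lt_u; have := no (elt sigma (Ordinal lt_u)).
  rewrite /class_pos (pos_elt sigma_cyclic) /= [nu _]nuu [ce _](negbTE cu) /=.
  by rewrite eu /q ej eqxx.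
have g_inj : {in I &, injective g}.
  move=> x y xI yI e; have [_ cx gx] := gP x xI; have [_ cy gy] := gP y yI.
  have ec : ce (pos x) = ce (pos y) by rewrite -cx -cy e.
  case E: (ce (pos y)); first by move: e; rewrite /g ec E.
  move: (gx (etrans ec E)); rewrite e gy // /q.
  have [i ei _] := phiA x xI; have [j ej _] := phiA y yI; rewrite ei ej.
  by move/(last_rank_inj cut_antichain) => eij; apply: phi_inj; rewrite // ei ej eij.
rewrite -(card_in_imset g_inj); apply/subset_leq_card/subsetP => _ /imsetP[x xI ->].
by have [] := gP x xI.
Qed.

Lemma mrank_greedy :
  mrank M (set_of_bits sigma w) = count id w - nblocked lo hi 0 s w.
Proof.
rewrite -card_X; apply/eqP; rewrite eqn_leq; apply/andP; split.
  by apply/bigmax_leqP => I /andP[]; apply: indep_le.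
by apply: (bigmax_sup X) => //; rewrite X_indep X_sub.
Qed.

Lemma nblocked_nullity : nblocked lo hi 0 s w =
  #|set_of_bits sigma w| - mrank M (set_of_bits sigma w).
Proof.
rewrite card_set_of_bits // mrank_greedy.
by have := nblocked_le lo hi 0 s w; lia.
Qed.

(** For a fixed start conservation reads m + blocks = expiries + |B|, and the rank is |B| minus the
    blocks. *)
Lemma nexpired_corank :
  nexpired lo hi 0 s w = m - mrank M (set_of_bits sigma w).
Proof.
rewrite mrank_greedy; have := gfinal_count lo hi 0 s w.
have := nblocked_le lo hi 0 s w; rewrite s_fixed; lia.
Qed.

Lemma mrank_le_nintervals : mrank M (set_of_bits sigma w) <= m.
Proof.
rewrite mrank_greedy; have := gfinal_count lo hi 0 s w.
have := nblocked_le lo hi 0 s w; rewrite s_fixed; lia.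
Qed.

End Rank.

Lemma fixed_start (w : n.-tuple bool) : exists2 s, s <= hi 0 &
  forall s', s' <= hi 0 ->
    touches lo hi 0 s' w && (gfinal lo hi 0 s' w == s' + m) = (s' == s).
Proof.
apply: fixed_start_unique.
- exact: lo_le_hi_count.
- by move=> t; apply: hi_count_mono.
- exact: lo_count0.
- by rewrite size_tuple lo_end.
rewrite size_tuple; have /andP[_ h] := hi_count_bounds F L n.
by have /andP[h' _] := hi_count_bounds F L 0; rewrite /hi; lia.
Qed.

(** The scan of the full set bounds the rank by m; the distinct first elements of the intervals form
    a transversal of size m. *)
Lemma mrank_setT : mrank M setT = m.
Proof.
apply/eqP; rewrite eqn_leq; apply/andP; split.
  pose w := [tuple true | i < n].
  have -> : [set: S] = set_of_bits sigma w.
    apply/setP => x; rewrite !inE -[pos x]/(val (pos_ord sigma_cyclic x)).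
    by rewrite -tnth_nth tnth_mktuple.
  have [s le_s /(_ s le_s)] := fixed_start w.
  by rewrite eqxx => /andP[_ /eqP]; apply: mrank_le_nintervals.
have f_inj : injective f.
  by move=> i j e; apply: (first_pos_inj cut_antichain); rewrite /F e.
apply: (bigmax_sup (f @: setT)); last by rewrite card_imset // cardsT card_ord.
rewrite subsetT andbT inE; apply/partial_transversalP.
exists (fun x => [pick j | f j == x]) => [_ _ /imsetP[i _ ->] /imsetP[j _ ->]|].
  case: pickP => [i' /eqP/f_inj ->|/(_ i)]; last by rewrite eqxx.
  case: pickP => [j' /eqP/f_inj ->|/(_ j)]; last by rewrite eqxx.
  by case=> ->.
move=> _ /imsetP[i _ ->]; exists i; last first.
  by rewrite mem_A_in_cut /in_cut /wraps /F /L; case: ltnP => ?; lia.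
by case: pickP => [i' /eqP/f_inj ->|/(_ i)] //; rewrite eqxx.
Qed.

Local Open Scope ring_scope.

(** After exchanging the sums, each subset contributes at exactly one start, and its path weight
    there is its term of the Tutte polynomial. *)
Lemma tutte_tabU : tutte M = \sum_(s < (hi 0).+1) tabU lo hi n (s + m) n s.
Proof.
rewrite /tutte (sum_set_of_bits sigma_cyclic) mrank_setT.
under [RHS]eq_bigr => s _ do rewrite tabU_sum // big_mkcond /=.
rewrite exchange_big /=; apply: eq_bigr => w _.
have [s le_s uniq_s] := fixed_start w.
rewrite (bigD1 (inord s)) //= big1 ?addr0 => [|s' neq_s]; last first.
  rewrite subnn uniq_s; last by rewrite -ltnS.
  by case: (eqVneq (s' : nat) s) => // e; case/eqP: neq_s; apply: val_inj; rewrite /= inordK.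
have := uniq_s _ le_s; rewrite inordK ?ltnS // subnn eqxx => fs; rewrite fs.
move: fs => /andP[_ /eqP fs].
by rewrite /gweight (nexpired_corank le_s fs) (nblocked_nullity le_s fs).
Qed.

Lemma coef_weight (a b i j : nat) :
  ((('X - 1) ^+ a * ('X%:P - 1) ^+ b : {poly {poly int}})`_i)`_j =
  (('X - 1 : {poly int}) ^+ a)`_i * (('X - 1 : {poly int}) ^+ b)`_j.
Proof.
have -> : ('X - 1 : {poly {poly int}}) ^+ a = map_poly polyC (('X - 1) ^+ a).
  by rewrite rmorphXn /= rmorphB /= map_polyX rmorph1.
have -> : ('X%:P - 1 : {poly {poly int}}) ^+ b = (('X - 1) ^+ b)%:P.
  by rewrite polyC_exp polyCB polyC1.
by rewrite coefMC coef_map /= coefCM.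
Qed.

Lemma coef_tutte_eq0 (i j : nat) : (n < i)%N || (n < j)%N -> (tutte M)`_i`_j = 0.
Proof.
move=> gt_n; rewrite /tutte !coef_sum big1 // => B _; rewrite coef_weight.
have coef0 a k : (a <= n)%N -> (n < k)%N -> (('X - 1 : {poly int}) ^+ a)`_k = 0.
  move=> le_a lt_k; apply: nth_default.
  by rewrite -polyC1 size_exp_XsubC; apply: leq_ltn_trans lt_k.
have le_B : (#|B| <= n)%N by apply: max_card.
case/orP: gt_n => gt_n.
  by rewrite (coef0 _ i) ?mul0r // mrank_setT; have := leq_nintervals; lia.
by rewrite (coef0 _ j) ?mulr0 //; lia.
Qed.

End MultiPath.

(** * Polynomials in two variables from their coefficients *)

Lemma poly_expand (R : nzRingType) (n : nat) (p : {poly R}) :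
  (forall j, (n < j)%N -> p`_j = 0)%R ->
  (\sum_(j < n.+1) (p`_j)%:P * 'X ^+ j)%R = p.
Proof.
move=> p0; under eq_bigr => j _ do rewrite mul_polyC.
rewrite -poly_def; apply/polyP => j; rewrite coef_poly ltnS.
by case: leqP => // /p0.
Qed.

Lemma poly2_expand (n : nat) (P : {poly {poly int}}) :
  (forall i j, (n < i)%N || (n < j)%N -> P`_i`_j = 0)%R ->
  (\sum_(i < n.+1) \sum_(j < n.+1)
     (P`_i`_j)%:P%:P * 'X ^+ i * 'X%:P ^+ j)%R = P.
Proof.
move=> P0; rewrite -[RHS](@poly_expand _ n) => [|i lt_i]; last first.
  by apply/polyP => j; rewrite P0 ?lt_i // coef0.
apply: eq_bigr => i _.
rewrite -[in RHS](@poly_expand _ n (P`_i)) => [|j lt_j]; last first.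
  by rewrite P0 // lt_j orbT.
rewrite rmorph_sum mulr_suml; apply: eq_bigr => j _.
by rewrite rmorphM rmorphXn /= mulrAC.
Qed.

(** * Counting loops *)

(* PFor x y p runs p for x = 0, ..., y - 1; p must change neither x nor y. *)
Inductive prog :=
| PSet of nat & aexp
| PPut of nat & aexp & aexp
| PSeq of prog & prog
| PIf of bexp & prog & prog
| PFor of nat & nat & prog.

Fixpoint compile p : cmd :=
  match p with
  | PSet x e => CAssign x e
  | PPut a e1 e2 => CStore a e1 e2
  | PSeq p q => CSeq (compile p) (compile q)
  | PIf b p q => CIf b (compile p) (compile q)
  | PFor x y p =>
      CSeq (CAssign x (ANum 0))
        (CWhile (BNot (BLe (AVar y) (AVar x)))
           (CSeq (compile p) (CAssign x (AAdd (AVar x) (ANum 1)))))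
  end.

Definition incr_var x s := set_var s x (vars s x + 1)%R.

Lemma incr_var_neq x z s : z != x -> vars (incr_var x s) z = vars s z.
Proof. by move=> /negbTE /= ->. Qed.

(** A negative loop bound means no iteration, as in the compiled loop. *)
Definition nat_of_int (z : int) : nat := if z is Posz k then k else 0.

Fixpoint sem p s : state :=
  match p with
  | PSet x e => set_var s x (aeval s e)
  | PPut a e1 e2 => set_arr s a (aeval s e1) (aeval s e2)
  | PSeq p q => sem q (sem p s)
  | PIf b p q => if beval s b then sem p s else sem q s
  | PFor x y p =>
      iter (nat_of_int (vars s y)) (fun s => incr_var x (sem p s))
        (set_var s x 0)
  end.

Fixpoint mod_vars p : seq nat :=
  match p with
  | PSet x _ => [:: x]
  | PPut _ _ _ => [::]
  | PSeq p q | PIf _ p q => mod_vars p ++ mod_vars q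
  | PFor x _ p => x :: mod_vars p
  end.

Fixpoint mod_arrs p : seq nat :=
  match p with
  | PSet _ _ => [::]
  | PPut a _ _ => [:: a]
  | PSeq p q | PIf _ p q => mod_arrs p ++ mod_arrs q
  | PFor _ _ p => mod_arrs p
  end.

Fixpoint bound_vars p : seq nat :=
  match p with
  | PSet _ _ | PPut _ _ _ => [::]
  | PSeq p q | PIf _ p q => bound_vars p ++ bound_vars q
  | PFor _ y p => y :: bound_vars p
  end.

Fixpoint wf_prog p : bool :=
  match p with
  | PSet _ _ | PPut _ _ _ => true
  | PSeq p q | PIf _ p q => wf_prog p && wf_prog q
  | PFor x y p => [&& x \notin mod_vars p, y \notin x :: mod_vars p & wf_prog p]
  end.

Fixpoint loop_depth p : nat :=
  match p with
  | PSet _ _ | PPut _ _ _ => 0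
  | PSeq p q | PIf _ p q => maxn (loop_depth p) (loop_depth q)
  | PFor _ _ p => (loop_depth p).+1
  end.

(** Both branches of a conditional are charged. The 16 of a loop is 9 for the test and increment of
    an iteration plus 7 for the initialisation and the failing test. *)
Fixpoint prog_weight p : nat :=
  match p with
  | PSet _ e => (acost e).+1
  | PPut _ e1 e2 => (acost e1 + acost e2).+1
  | PSeq p q => prog_weight p + prog_weight q
  | PIf b p q => (bcost b).+1 + prog_weight p + prog_weight q
  | PFor _ _ p => prog_weight p + 16
  end.

Lemma sem_var p s z : z \notin mod_vars p -> vars (sem p s) z = vars s z.
Proof.
elim: p s => [x e|a e1 e2|p IHp q IHq|b p IHp q IHq|x y p IH] s /=.
- by rewrite inE => /negbTE ->.
- by [].
- by rewrite mem_cat negb_or => /andP[hp hq]; rewrite IHq // IHp.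
- by rewrite mem_cat negb_or => /andP[hp hq]; case: ifP => _; [apply: IHp|apply: IHq].
rewrite inE negb_or => /andP[zx zp].
by elim: (nat_of_int _) => [|k IHk] /=; rewrite (negbTE zx) // IH.
Qed.

Lemma sem_arr p s a i : a \notin mod_arrs p -> arrs (sem p s) a i = arrs s a i.
Proof.
elim: p s => [x e|b e1 e2|p IHp q IHq|b p IHp q IHq|x y p IH] s //=.
- by rewrite inE => /negbTE ->.
- by rewrite mem_cat negb_or => /andP[hp hq]; rewrite IHq // IHp.
- by rewrite mem_cat negb_or => /andP[hp hq]; case: ifP => _; [apply: IHp|apply: IHq].
by move=> ap; elim: (nat_of_int _) => [|k IHk] //=; rewrite IH.
Qed.

(** Invariant rule for loops; the index of the invariant is also the value of the counter. *)
Lemma sem_for_ind (I : nat -> state -> Prop) x y p s N :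
  x \notin mod_vars p -> vars s y = Posz N ->
  I 0 (set_var s x 0%R) ->
  (forall k t, k < N -> vars t x = Posz k -> I k t -> I k.+1 (incr_var x (sem p t))) ->
  I N (sem (PFor x y p) s).
Proof.
move=> xp yN I0 IS; rewrite /= yN /=.
have h k : k <= N -> let t := iter k (fun s => incr_var x (sem p s)) (set_var s x 0%R) in
    vars t x = Posz k /\ I k t.
  elim: k => [|k IHk] lt_k /=; first by rewrite eqxx.
  have [e It] := IHk (ltnW lt_k); split; last exact: IS.
  by rewrite eqxx sem_var // e; lia.
by have [] := h N (leqnn N).
Qed.

(** V contains all variables that may change, and loop bounds lie outside V, so a bound checked in
    the initial state stays valid inside every loop. Each nesting level then costs a factor B +
    1. *)
Lemma compile_exec p (V : seq nat) B s :
  wf_prog p -> {subset mod_vars p <= V} ->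
  (forall y, y \in bound_vars p -> y \notin V /\ (vars s y <= Posz B)%R) ->
  exists2 k, exec (compile p) s k (sem p s) &
    k <= prog_weight p * B.+1 ^ loop_depth p.
Proof.
elim: p s => [x e|a e1 e2|p IHp q IHq|b p IHp q IHq|x y p IH] s /=.
- by exists (acost e).+1; [apply: ExecAssign|rewrite expn0 muln1].
- by exists (acost e1 + acost e2).+1; [apply: ExecStore|rewrite expn0 muln1].
- move=> /andP[wp wq] sub bnd.
  have [|y yp|k1 e1 le1] := IHp s wp; first by move=> z zp; apply: sub; rewrite mem_cat zp.
    by apply: bnd; rewrite mem_cat yp.
  have [|y yq|k2 e2 le2] := IHq (sem p s) wq.
  + by move=> z zq; apply: sub; rewrite mem_cat zq orbT.
  + have /bnd[yV le_y] : y \in bound_vars p ++ bound_vars q by rewrite mem_cat yq orbT.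
    rewrite sem_var //; apply: contra yV => yp; apply: sub.
    by rewrite mem_cat yp.
  exists (k1 + k2); first exact: ExecSeq e1 e2.
  rewrite mulnDl; apply: leq_add.
    by apply: leq_trans le1 _; rewrite leq_mul2l leq_pexp2l ?leq_maxl ?orbT.
  by apply: leq_trans le2 _; rewrite leq_mul2l leq_pexp2l ?leq_maxr ?orbT.
- move=> /andP[wp wq] sub bnd.
  have [|y yp|k1 e1 le1] := IHp s wp; first by move=> z zp; apply: sub; rewrite mem_cat zp.
    by apply: bnd; rewrite mem_cat yp.
  have [|y yq|k2 e2 le2] := IHq s wq.
  + by move=> z zq; apply: sub; rewrite mem_cat zq orbT.
  + by apply: bnd; rewrite mem_cat yq orbT.
  set D := B.+1 ^ _.
  have {}le1 : k1 <= prog_weight p * D.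
    by apply: leq_trans le1 _; rewrite leq_mul2l leq_pexp2l ?leq_maxl ?orbT.
  have {}le2 : k2 <= prog_weight q * D.
    by apply: leq_trans le2 _; rewrite leq_mul2l leq_pexp2l ?leq_maxr ?orbT.
  have D_gt0 : 0 < D by rewrite expn_gt0.
  have le_b : (bcost b).+1 <= (bcost b).+1 * D by rewrite leq_pmulr.
  rewrite !mulnDl.
  case E: (beval s b).
    exists (bcost b + k1).+1; first by apply: ExecIf; rewrite E.
    by move: le1 le2 le_b; lia.
  exists (bcost b + k2).+1; first by apply: ExecIf; rewrite E.
  by move: le1 le2 le_b; lia.
move=> /and3P[xp yxp wp] sub bnd.
have [yV le_y] := bnd y (mem_head _ _).
set c := CWhile _ _; set g := fun s => incr_var x (sem p s).
set N := nat_of_int (vars s y).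
have le_N : N <= B by rewrite /N; case: (vars s y) le_y.
set K := prog_weight p * B.+1 ^ loop_depth p.
(* Here j iterations are done and d remain. The integer inequality beside N = j + d covers a
   negative bound, and 5 is the cost of the failing test. *)
have while_exec d t : (forall z, z \notin V -> vars t z = vars s z) ->
    (exists2 j, vars t x = Posz j & (vars s y <= Posz (j + d))%R /\ N = j + d) ->
    exists2 k, exec c t k (iter d g t) & k <= d * (K + 9) + 5.
  elim: d t => [|d IHd] t frame [j xj [le_yj NE]].
    exists 5; last by [].
    apply: (@ExecWhileFalse t) => /=.
    by rewrite negbK frame // xj; rewrite addn0 in le_yj.
  have [|z zp|k1 e1 le1] := IH t wp.
  + by move=> z zp; apply: sub; rewrite inE zp orbT.
  + have /bnd[zV le_z] : z \in y :: bound_vars p by rewrite inE zp orbT.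
    by split; rewrite ?frame.
  have gx : vars (g t) x = Posz j.+1.
    by rewrite /g /= eqxx sem_var // xj; lia.
  have [||k2 e2 le2] := IHd (g t).
  + move=> z zV; have zm : z \notin x :: mod_vars p by apply: contra zV => /sub.
    rewrite inE negb_or in zm; case/andP: zm => zx zp.
    by rewrite /g /= (negbTE zx) sem_var // frame.
  + by exists j.+1 => //; rewrite addSnnS.
  exists (4 + (k1 + 4) + k2).+1; last by rewrite -/K in le1; lia.
  rewrite iterSr; apply: (@ExecWhileTrue t (g t)) e2 => /=.
    rewrite frame // xj; move: NE; rewrite /N.
    by case: (vars s y) => a /= NE; lia.
  by apply: ExecSeq e1 _; apply: (ExecAssign _ x (AAdd (AVar x) (ANum 1))).
have [|| k e le_k] := while_exec N (set_var s x 0%R).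
- move=> z zV /=; case: eqP => // zx; case/negP: zV; apply: sub.
  by rewrite zx mem_head.
- exists 0; rewrite /= ?eqxx // add0n; split=> //.
  by rewrite /N; case: (vars s y).
exists (2 + k); first by apply: ExecSeq e; apply: (ExecAssign _ x (ANum 0)).
rewrite expnS; have D_gt0 : 0 < B.+1 ^ loop_depth p by rewrite expn_gt0.
apply: (@leq_trans (B.+1 * (K + 16))).
  have : N * (K + 9) <= B * (K + 9) by rewrite leq_mul2r le_N orbT.
  by rewrite mulSn !mulnDr; lia.
rewrite mulnCA leq_mul2l mulnDl /K leq_add2l; apply/orP; right.
by rewrite leq_pmulr.
Qed.

(** * The program *)

Section TableCoefficients.
Variables (lo hi : nat -> nat) (n tgt : nat).
Local Open Scope ring_scope.

Definition coefT k p (i j : nat) : int := (tabT lo hi n tgt k p)`_i`_j.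
Definition coefU k p (i j : nat) : int := (tabU lo hi n tgt k p)`_i`_j.

Lemma coef_XsubM (Q : {poly {poly int}}) (i j : nat) :
  (('X - 1) * Q)`_i`_j = (if (0 < i)%N then Q`_i.-1`_j else 0) - Q`_i`_j.
Proof. by rewrite mulrBl mul1r coefB coefXM coefB; case: i => [|i] //=; rewrite coef0. Qed.

Lemma coef_YsubM (Q : {poly {poly int}}) (i j : nat) :
  (('X%:P - 1) * Q)`_i`_j = (if (0 < j)%N then Q`_i`_j.-1 else 0) - Q`_i`_j.
Proof. by rewrite mulrBl mul1r coefB coefCM coefB coefXM; case: j. Qed.

Lemma coefT_expire k p i j : (p < lo (n - k))%N ->
  coefT k p i j = (if (0 < i)%N then coefT k p.+1 i.-1 j else 0) - coefT k p.+1 i j.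
Proof. by move=> lt_p; rewrite /coefT tabT_expire // coef_XsubM. Qed.

Lemma coefT0 p i j : (lo n <= p)%N ->
  coefT 0 p i j = ((p == tgt) && (i + j == 0)%N)%:R.
Proof.
move=> le_p; rewrite /coefT tabT0 //; case: (p == tgt); rewrite /= ?coef0 //.
by rewrite mulr1n coef1; case: i => [|i] /=; rewrite ?coef0 // coef1.
Qed.

Lemma coefT_step k p i j : (lo (n - k.+1) <= p < hi (n - k.+1))%N ->
  coefT k.+1 p i j = coefT k p i j + coefT k p.+1 i j.
Proof. by case/andP=> le_p lt_p; rewrite /coefT tabTS // lt_p !coefD. Qed.

(** Both letters lead to the same entry Q, and Q + (y - 1) Q = y Q is a shift in j. *)
Lemma coefT_block k p i j : (lo (n - k.+1) <= p)%N -> (hi (n - k.+1) <= p)%N ->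
  coefT k.+1 p i j = if (0 < j)%N then coefT k p i j.-1 else 0.
Proof.
move=> le_p ge_p; rewrite /coefT tabTS // ltnNge ge_p !coefD coef_YsubM.
by rewrite addrC subrK.
Qed.

Lemma coefU_touch k p i j : (p <= lo (n - k))%N -> coefU k p i j = coefT k p i j.
Proof. by rewrite /coefU; case: k => [|k] /= ->. Qed.

Lemma coefU0 p i j : (lo n < p)%N -> coefU 0 p i j = 0.
Proof. by move=> lt_p; rewrite /coefU /= subn0 leqNgt lt_p !coef0. Qed.

Lemma coefU_step k p i j : (lo (n - k.+1) < p < hi (n - k.+1))%N ->
  coefU k.+1 p i j = coefU k p i j + coefU k p.+1 i j.
Proof. by case/andP=> lt_lo lt_p; rewrite /coefU /= leqNgt lt_lo lt_p !coefD. Qed.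

(** A block counts as a touch and enters [tabT], so U + (y - 1) T does not collapse. *)
Lemma coefU_block k p i j : (lo (n - k.+1) < p)%N -> (hi (n - k.+1) <= p)%N ->
  coefU k.+1 p i j = coefU k p i j - coefT k p i j +
                     (if (0 < j)%N then coefT k p i j.-1 else 0).
Proof.
move=> lt_lo ge_p; rewrite /coefU /= leqNgt lt_lo.
have -> : (p < hi (n - k.+1))%N = false by lia.
rewrite !coefD coef_YsubM.
by rewrite -addrA; congr (_ + _); rewrite addrC.
Qed.

End TableCoefficients.

Local Notation "$ x" := (AVar x) (at level 1, format "$ x").

Definition BLt e1 e2 := BNot (BLe e2 e1).

(* Variables
     0 n, 1 m, 2 n + 1, 3 2n + 1, 4 (n + 1)^2, 5 (2n + 1)(n + 1)^2, 6 hi 0 + 1,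
     12 start pointer s, 13 k = n - t, 14 2n - p, 15 i, 16 j, 17 current cell,
     18 output cell, 19 (s + 1)(n + 1)^2, 20 and 21 new entries, 22 p, 23 lo t,
     24 hi t, 7-11 temporaries of the preprocessing.
   Arrays
     3 output, 4 pos, 5 coefT, 6 coefU, 7 lo, 8 hi. *)
Definition load_body :=
  PSeq (PSet 22 (ASub (AAdd $0 $0) $14))
 (PSeq (PSet 23 (AGet 7 (ASub $0 $13)))
       (PSet 24 (AGet 8 (ASub $0 $13)))).

(** From the current cell, subtracting [$4] moves to p + 1, [$5] to row k - 1, [$2] to i - 1 and 1
    to j - 1. The cases follow [coefT_expire], [coefT0], [coefT_step] and [coefT_block]. *)
Definition T_body :=
  PIf (BLt $22 $23)
    (PIf (BLe (ANum 1) $15)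
      (PSet 20 (ASub (AGet 5 (ASub (ASub $17 $4) $2)) (AGet 5 (ASub $17 $4))))
      (PSet 20 (ASub (ANum 0) (AGet 5 (ASub $17 $4)))))
    (PIf (BLe $13 (ANum 0))
      (PIf (BAnd (BAnd (BLe $22 (AAdd $12 $1)) (BLe (AAdd $12 $1) $22))
                 (BLe (AAdd $15 $16) (ANum 0)))
        (PSet 20 (ANum 1)) (PSet 20 (ANum 0)))
      (PIf (BLt $22 $24)
        (PSet 20 (AAdd (AGet 5 (ASub $17 $5)) (AGet 5 (ASub (ASub $17 $5) $4))))
        (PIf (BLe (ANum 1) $16)
          (PSet 20 (AGet 5 (ASub (ASub $17 $5) (ANum 1))))
          (PSet 20 (ANum 0))))).

(** Variable 20 still holds the [coefT] entry of the same cell, which is the answer when the path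
    touches. *)
Definition U_body :=
  PIf (BLe $22 $23)
    (PSet 21 $20)
    (PIf (BLe $13 (ANum 0))
      (PSet 21 (ANum 0))
      (PIf (BLt $22 $24)
        (PSet 21 (AAdd (AGet 6 (ASub $17 $5)) (AGet 6 (ASub (ASub $17 $5) $4))))
        (PIf (BLe (ANum 1) $16)
          (PSet 21 (AAdd (ASub (AGet 6 (ASub $17 $5)) (AGet 5 (ASub $17 $5)))
                         (AGet 5 (ASub (ASub $17 $5) (ANum 1)))))
          (PSet 21 (ASub (AGet 6 (ASub $17 $5)) (AGet 5 (ASub $17 $5))))))).

Definition store_body :=
  PSeq (PPut 5 $17 $20) (PSeq (PPut 6 $17 $21) (PSet 17 (AAdd $17 (ANum 1)))).

Definition cell_body := PSeq load_body (PSeq T_body (PSeq U_body store_body)).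

Definition fill_table :=
  PSeq (PSet 17 (ANum 0))
    (PFor 13 2 (PFor 14 3 (PFor 15 2 (PFor 16 2 cell_body)))).

(** After a filling [$17] is the size of the table, so [$17 - $19] is the first cell of row n at
    pointer s. *)
Definition out_body :=
  PSeq (PPut 3 $18 (AAdd (AGet 3 $18) (AGet 6 (AAdd (ASub $17 $19) $18))))
       (PSet 18 (AAdd $18 (ANum 1))).

Definition add_output :=
  PSeq (PSet 19 (AAdd $19 $4))
 (PSeq (PSet 18 (ANum 0)) (PFor 15 2 (PFor 16 2 out_body))).

Definition tutte_main := PFor 12 6 (PSeq fill_table add_output).

(** * Correctness of the table *)

Section Main.
Variables (n m : nat) (lo hi : nat -> nat).
Hypothesis hi_le : forall t, hi t <= n + n.
Hypothesis lo_le : forall t, lo t <= n + n.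

Local Notation N := n.+1.
Local Notation P := (n + n).+1.

(** The pointer enters as pp = 2n - p: an expiry refers to p + 1 in the same row, and this order
    makes that an earlier cell. *)
Definition cell k pp i j := ((k * P + pp) * N + i) * N + j.

Lemma cellSj k pp i j : cell k pp i j.+1 = (cell k pp i j).+1.
Proof. by rewrite /cell addnS. Qed.
Lemma cellSi k pp i j : cell k pp i.+1 j = cell k pp i j + N.
Proof. by rewrite /cell; lia. Qed.
Lemma cellSp k pp i j : cell k pp.+1 i j = cell k pp i j + N * N.
Proof. by rewrite /cell; lia. Qed.
Lemma cellSk k pp i j : cell k.+1 pp i j = cell k pp i j + P * (N * N).
Proof. by rewrite /cell; lia. Qed.

Lemma euclid_inj d a b r r' : r < d -> r' < d -> a * d + r = b * d + r' ->
  a = b /\ r = r'.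
Proof.
move=> lt_r lt_r' e; have ab : a = b.
  have := congr1 (divn^~ d) e; rewrite /= !divnMDl ?(divn_small lt_r) ?(divn_small lt_r'); lia.
by split=> //; move: e; rewrite ab; lia.
Qed.

Lemma cell_inj k pp i j k' pp' i' j' : pp < P -> i < N -> j < N ->
  pp' < P -> i' < N -> j' < N -> cell k pp i j = cell k' pp' i' j' ->
  [/\ k = k', pp = pp', i = i' & j = j'].
Proof.
move=> hp hi' hj hp' hi'' hj' /(euclid_inj hj hj')[].
by move=> /(euclid_inj hi' hi'')[] /(euclid_inj hp hp')[] -> -> -> ->.
Qed.

Record tenv (s : nat) (st : state) : Prop := TEnv {
  env_n : vars st 0 = Posz n;
  env_m : vars st 1 = Posz m;
  env_N : vars st 2 = Posz N;
  env_P : vars st 3 = Posz P;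
  env_sp : vars st 4 = Posz (N * N);
  env_sk : vars st 5 = Posz (P * (N * N));
  env_s : vars st 12 = Posz s;
  env_lo : forall t, t <= n -> arrs st 7 (Posz t) = Posz (lo t);
  env_hi : forall t, t <= n -> arrs st 8 (Posz t) = Posz (hi t) }.

Lemma tenv_sem p s st :
  all (fun z => z \notin mod_vars p) [:: 0; 1; 2; 3; 4; 5; 12] ->
  7 \notin mod_arrs p -> 8 \notin mod_arrs p -> tenv s st -> tenv s (sem p st).
Proof.
rewrite /= => /and5P[h0 h1 h2 h3 /and4P[h4 h5 h12 _]] h7 h8 [? ? ? ? ? ? ? e7 e8].
by split; rewrite ?sem_var // => t le_t; rewrite sem_arr // ?e7 ?e8.
Qed.

Definition done s c (st : state) := forall k pp i j,
  pp < P -> i < N -> j < N -> cell k pp i j < c ->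
  arrs st 5 (Posz (cell k pp i j)) = coefT lo hi n (s + m) k (n + n - pp) i j /\
  arrs st 6 (Posz (cell k pp i j)) = coefU lo hi n (s + m) k (n + n - pp) i j.

Section Cell.
Variables (s k pp i j : nat) (st : state).
Hypotheses (k_le : k <= n) (pp_lt : pp < P) (i_lt : i < N) (j_lt : j < N).
Hypothesis st_env : tenv s st.
Hypothesis st_done : done s (cell k pp i j) st.
Hypotheses (st13 : vars st 13 = Posz k) (st14 : vars st 14 = Posz pp)
  (st15 : vars st 15 = Posz i) (st16 : vars st 16 = Posz j)
  (st17 : vars st 17 = Posz (cell k pp i j)).
Let p := n + n - pp.
Local Notation cT := (coefT lo hi n (s + m)).
Local Notation cU := (coefU lo hi n (s + m)).

Lemma read_prev z k' p' i' j' : p' <= n + n -> i' < N -> j' < N ->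
  z = Posz (cell k' (n + n - p') i' j') ->
  cell k' (n + n - p') i' j' < cell k pp i j ->
  arrs st 5 z = cT k' p' i' j' /\ arrs st 6 z = cU k' p' i' j'.
Proof.
move=> hp hi' hj' -> lt_c.
have hp' : n + n - p' < P by lia.
by have := st_done hp' hi' hj' lt_c; rewrite subKn.
Qed.

Lemma load_correct : let st1 := sem load_body st in
  [/\ vars st1 22 = Posz p, vars st1 23 = Posz (lo (n - k))
    & vars st1 24 = Posz (hi (n - k))].
Proof.
rewrite /= !(env_n st_env) st13 st14.
have -> : (Posz n - Posz k)%R = Posz (n - k) by lia.
rewrite (env_lo st_env) ?(env_hi st_env) ?leq_subr //; split=> //; rewrite /p; lia.
Qed.

Section Values.
Hypotheses (st22 : vars st 22 = Posz p) (st23 : vars st 23 = Posz (lo (n - k)))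
  (st24 : vars st 24 = Posz (hi (n - k))).

Lemma T_correct : vars (sem T_body st) 20 = cT k p i j.
Proof.
have lei : (1 <= Posz i)%R = (0 < i) by [].
have lej : (1 <= Posz j)%R = (0 < j) by [].
rewrite /= st22 st23 st24 st13 st15 st16 st17 (env_sp st_env) (env_N st_env)
  (env_sk st_env) (env_s st_env) (env_m st_env) lei lej.
have p_le : p <= n + n by rewrite leq_subr.
have [lt_lo|ge_lo] := ltnP p (lo (n - k)).
  rewrite ifT; last by lia.
  (* An expiry needs p < [lo t] <= 2n, so p + 1 is still inside the table. *)
  have le_p' : p < n + n by apply: leq_trans lt_lo (lo_le _).
  have cE : cell k pp i j = cell k (n + n - p.+1) i j + N * N.
    by rewrite -cellSp; congr cell; lia.
  rewrite coefT_expire //.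
  have [r _] := @read_prev (Posz (cell k pp i j) - Posz (N * N))%R k p.+1 i j
    le_p' i_lt j_lt ltac:(lia) ltac:(lia).
  case: ltnP => lt_i /=; rewrite r //.
  have cE' : cell k (n + n - p.+1) i j = cell k (n + n - p.+1) i.-1 j + N.
    by rewrite -cellSi prednK.
  by have [-> _] := @read_prev (Posz (cell k pp i j) - Posz (N * N) - Posz N)%R
    k p.+1 i.-1 j le_p' ltac:(lia) j_lt ltac:(lia) ltac:(lia).
rewrite ifF; last by lia.
case: (posnP k) => [k0|k_gt0].
  rewrite ifT; last by lia.
  rewrite k0 coefT0 ?subn0; last by move: ge_lo; rewrite k0 subn0.
  case: ifP => h /=.
    by have -> : (p == s + m) && (i + j == 0) by lia.
  by have -> : (p == s + m) && (i + j == 0) = false by lia.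
rewrite ifF; last by lia.
have kE : k = k.-1.+1 by lia.
have cE : cell k pp i j = cell k.-1 (n + n - p) i j + P * (N * N).
  by rewrite -cellSk; congr cell; lia.
have [r _] := @read_prev (Posz (cell k pp i j) - Posz (P * (N * N)))%R k.-1 p i j
    p_le i_lt j_lt ltac:(lia) ltac:(lia).
have [lt_hi|ge_hi] := ltnP p (hi (n - k)).
  rewrite ifT /=; last by lia.
  have le_p' : p < n + n by apply: leq_trans lt_hi (hi_le _).
  have cE' : cell k.-1 (n + n - p) i j = cell k.-1 (n + n - p.+1) i j + N * N.
    by rewrite -cellSp; congr cell; lia.
  have [r' _] := @read_prev (Posz (cell k pp i j) - Posz (P * (N * N)) - Posz (N * N))%R
    k.-1 p.+1 i j le_p' i_lt j_lt ltac:(lia) ltac:(lia).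
  rewrite r r' kE coefT_step //; first by rewrite -kE ge_lo.
rewrite ifF /=; last by lia.
rewrite kE coefT_block -?kE //; case: ltnP => lt_j //=.
have cE' : cell k.-1 (n + n - p) i j = (cell k.-1 (n + n - p) i j.-1).+1.
  by rewrite -cellSj prednK.
by have [-> _] := @read_prev (Posz (cell k pp i j) - Posz (P * (N * N)) - 1)%R
    k.-1 p i j.-1 p_le i_lt ltac:(lia) ltac:(lia) ltac:(lia).
Qed.

Lemma U_correct : vars st 20 = cT k p i j -> vars (sem U_body st) 21 = cU k p i j.
Proof.
move=> st20; have lej : (1 <= Posz j)%R = (0 < j) by [].
rewrite /= st22 st23 st24 st13 st16 st17 st20 (env_sp st_env) (env_sk st_env) lej.
have p_le : p <= n + n by rewrite leq_subr.
have [le_lo|gt_lo] := leqP p (lo (n - k)).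
  by rewrite ifT /=; [rewrite coefU_touch|lia].
rewrite ifF; last by lia.
case: (posnP k) => [k0|k_gt0].
  rewrite ifT /=; last by lia.
  by rewrite k0 coefU0 //; move: gt_lo; rewrite k0 subn0.
rewrite ifF; last by lia.
have kE : k = k.-1.+1 by lia.
have cE : cell k pp i j = cell k.-1 (n + n - p) i j + P * (N * N).
  by rewrite -cellSk; congr cell; lia.
have [rT rU] := @read_prev (Posz (cell k pp i j) - Posz (P * (N * N)))%R k.-1 p i j
    p_le i_lt j_lt ltac:(lia) ltac:(lia).
have [lt_hi|ge_hi] := ltnP p (hi (n - k)).
  rewrite ifT /=; last by lia.
  have le_p' : p < n + n by apply: leq_trans lt_hi (hi_le _).
  have cE' : cell k.-1 (n + n - p) i j = cell k.-1 (n + n - p.+1) i j + N * N.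
    by rewrite -cellSp; congr cell; lia.
  have [_ r'] := @read_prev (Posz (cell k pp i j) - Posz (P * (N * N)) - Posz (N * N))%R
    k.-1 p.+1 i j le_p' i_lt j_lt ltac:(lia) ltac:(lia).
  by rewrite rU r' kE coefU_step // -kE gt_lo.
rewrite ifF /=; last by lia.
rewrite kE coefU_block -?kE //; case: ltnP => lt_j /=; rewrite rT rU ?addr0 //.
have cE' : cell k.-1 (n + n - p) i j = (cell k.-1 (n + n - p) i j.-1).+1.
  by rewrite -cellSj prednK.
by have [-> _] := @read_prev (Posz (cell k pp i j) - Posz (P * (N * N)) - 1)%R
    k.-1 p i j.-1 p_le i_lt ltac:(lia) ltac:(lia) ltac:(lia).
Qed.

End Values.
End Cell.

Lemma done_eq s c st st' :
  (forall z, arrs st' 5 z = arrs st 5 z) -> (forall z, arrs st' 6 z = arrs st 6 z) ->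
  done s c st -> done s c st'.
Proof. by move=> e5 e6 h k pp i j *; rewrite e5 e6; apply: h. Qed.

Lemma done_sem p s c st : 5 \notin mod_arrs p -> 6 \notin mod_arrs p ->
  done s c st -> done s c (sem p st).
Proof. by move=> *; apply: (done_eq (st := st)) => // z; rewrite sem_arr. Qed.

Lemma cell_correct s k pp i j st :
  k <= n -> pp < P -> i < N -> j < N ->
  tenv s st -> done s (cell k pp i j) st ->
  vars st 13 = Posz k -> vars st 14 = Posz pp -> vars st 15 = Posz i ->
  vars st 16 = Posz j -> vars st 17 = Posz (cell k pp i j) ->
  let st' := sem cell_body st in
  vars st' 17 = Posz (cell k pp i j.+1) /\ done s (cell k pp i j.+1) st'.
Proof.
move=> hk hp hi' hj henv hdone s13 s14 s15 s16 s17.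
have [s22 s23 s24] : [/\ vars (sem load_body st) 22 = Posz (n + n - pp),
    vars (sem load_body st) 23 = Posz (lo (n - k))
    & vars (sem load_body st) 24 = Posz (hi (n - k))].
  exact: (@load_correct s k pp i j st).
rewrite -[sem cell_body st]/(sem store_body (sem U_body (sem T_body (sem load_body st)))).
set st1 := sem load_body st in s22 s23 s24 *.
have env1 : tenv s st1 by apply: tenv_sem.
have done1 : done s (cell k pp i j) st1 by apply: done_sem.
have T1 : vars (sem T_body st1) 20 = coefT lo hi n (s + m) k (n + n - pp) i j.
  by apply: (@T_correct s k pp i j st1) => //; rewrite sem_var.
set st2 := sem T_body st1 in T1 *.
have env2 : tenv s st2 by apply: tenv_sem.
have done2 : done s (cell k pp i j) st2 by apply: done_sem.
have U2 : vars (sem U_body st2) 21 = coefU lo hi n (s + m) k (n + n - pp) i j.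
  by apply: (@U_correct s k pp i j st2) => //; rewrite sem_var // sem_var.
set st3 := sem U_body st2 in U2 *.
have done3 : done s (cell k pp i j) st3 by apply: done_sem.
have T3 : vars st3 20 = vars st2 20 by rewrite sem_var.
have c3 : vars st3 17 = Posz (cell k pp i j) by rewrite !sem_var.
split; first by rewrite /= c3 cellSj; lia.
move=> k' pp' i' j' hp' hi'' hj'; rewrite cellSj ltnS leq_eqVlt /= c3 U2 T3 T1.
move=> /orP[/eqP e|lt_c]; last first.
  have ne : (Posz (cell k' pp' i' j') == Posz (cell k pp i j)) = false.
    by apply/eqP => -[e]; rewrite e ltnn in lt_c.
  by rewrite ne; apply: done3.
rewrite e eqxx.
by have [-> -> -> ->] := cell_inj hp' hi'' hj' hp hi' hj e.
Qed.

Definition tinv s c st := [/\ tenv s st, vars st 17 = Posz c & done s c st].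

Lemma tinv_set s c st x z :
  x \notin [:: 0; 1; 2; 3; 4; 5; 12; 17] -> tinv s c st -> tinv s c (set_var st x z).
Proof.
move=> hx [env c17 hdone].
have h y : y \in [:: 0; 1; 2; 3; 4; 5; 12; 17] -> vars (set_var st x z) y = vars st y.
  by move=> hy /=; case: eqP hx => // <-; rewrite hy.
by case: env => *; split; rewrite ?h //; split; rewrite ?h.
Qed.

Lemma fill_correct s st : tenv s st -> tinv s (cell N 0 0 0) (sem fill_table st).
Proof.
move=> env; have -> : sem fill_table st =
  sem (PFor 13 2 (PFor 14 3 (PFor 15 2 (PFor 16 2 cell_body)))) (set_var st 17 0%R) by [].
(* At cell 0 nothing is claimed about the tables, so entries left over from the previous start are
   harmless. *)
have inv0 : tinv s (cell 0 0 0 0) (set_var st 17 0%R).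
  by case: env => *; split => //.
move: (set_var st 17 0%R) inv0 => {env}st inv0.
have envN u c : tinv s c u -> vars u 2 = Posz N by case=> /env_N.
have envP u c : tinv s c u -> vars u 3 = Posz P by case=> /env_P.
apply: (@sem_for_ind (fun k st => tinv s (cell k 0 0 0) st)) => //.
- exact: envN inv0.
- exact: tinv_set.
move=> k st1 lt_k st13 inv1; apply: tinv_set => //.
have -> : cell k.+1 0 0 0 = cell k P 0 0 by rewrite /cell; lia.
have [] : vars (sem (PFor 14 3 (PFor 15 2 (PFor 16 2 cell_body))) st1) 13 = Posz k /\
  tinv s (cell k P 0 0) (sem (PFor 14 3 (PFor 15 2 (PFor 16 2 cell_body))) st1) => //.
apply: (@sem_for_ind (fun pp st => vars st 13 = Posz k /\ tinv s (cell k pp 0 0) st)) => //.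
- exact: envP inv1.
- by split=> //; apply: tinv_set.
move=> pp st2 lt_pp st14 [{}st13 inv2]; split; first by rewrite incr_var_neq // sem_var.
apply: tinv_set => //; have -> : cell k pp.+1 0 0 = cell k pp N 0 by rewrite /cell; lia.
pose I u := vars u 13 = Posz k /\ vars u 14 = Posz pp.
have [] : I (sem (PFor 15 2 (PFor 16 2 cell_body)) st2) /\
  tinv s (cell k pp N 0) (sem (PFor 15 2 (PFor 16 2 cell_body)) st2) => //.
apply: (@sem_for_ind (fun i st => I st /\ tinv s (cell k pp i 0) st)) => //.
- exact: envN inv2.
- by split=> //; apply: tinv_set.
move=> i st3 lt_i st15 [[{}st13 {}st14] inv3].
split; first by split; rewrite incr_var_neq // sem_var.
apply: tinv_set => //; have -> : cell k pp i.+1 0 = cell k pp i N by rewrite /cell; lia.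
pose I' u := [/\ vars u 13 = Posz k, vars u 14 = Posz pp & vars u 15 = Posz i].
have [] : I' (sem (PFor 16 2 cell_body) st3) /\
  tinv s (cell k pp i N) (sem (PFor 16 2 cell_body) st3) => //.
apply: (@sem_for_ind (fun j st => I' st /\ tinv s (cell k pp i j) st)) => //.
- exact: envN inv3.
- by split=> //; apply: tinv_set.
move=> j st4 lt_j st16 [[{}st13 {}st14 {}st15] [env4 st17 done4]].
split; first by split; rewrite incr_var_neq // sem_var.
apply: tinv_set => //.
have [c17 done5] := cell_correct lt_k lt_pp lt_i lt_j env4 done4 st13 st14 st15 st16 st17.
by split=> //; apply: tenv_sem.
Qed.

End Main.

(** * Summation over the starts *)

Section Output.
Variables (n m : nat) (lo hi : nat -> nat).
Hypothesis hi_le : forall t, hi t <= n + n.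
Hypothesis lo_le : forall t, lo t <= n + n.
Local Notation N := n.+1.
Local Notation P := (n + n).+1.
Local Notation tenv := (tenv n m lo hi).
Local Notation tinv := (tinv n m lo hi).
Local Notation cell := (cell n).
Local Notation cU s := (coefU lo hi n (s + m) n s).

Section Add.
Variables (s : nat) (acc : nat -> nat -> int).
Hypothesis s_le : s <= n + n.

(** [acc] is the output before this start; the first d output cells have already received their new
    term. *)
Definition out_inv d st :=
  [/\ tinv s (cell N 0 0 0) st, vars st 19 = Posz (s.+1 * (N * N)),
      vars st 18 = Posz d &
      forall i j, i < N -> j < N -> arrs st 3 (Posz (i * N + j)) =
        (acc i j + if (i * N + j < d)%N then cU s i j else 0)%R].

Lemma out_inv_set d st x z :
  x \notin [:: 0; 1; 2; 3; 4; 5; 12; 17; 18; 19] -> out_inv d st ->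
  out_inv d (set_var st x z).
Proof.
move=> hx [inv s19 s18 out]; split => //.
- apply: tinv_set => //; apply: contra hx; rewrite !inE.
  by move=> /or4P[->|->|->|/or4P[->|->|->|/orP[]->]]; rewrite ?orbT.
- by move=> /=; case: eqP hx => // <-.
by move=> /=; case: eqP hx => // <-.
Qed.

Lemma out_body_correct i j st : i < N -> j < N -> out_inv (i * N + j) st ->
  out_inv (i * N + j.+1) (sem out_body st).
Proof.
move=> lt_i lt_j [[env s17 hdone] s19 s18 out].
have cE : cell N 0 0 0 + (i * N + j) = cell n (n + n - s) i j + s.+1 * (N * N).
  have e : P = s.+1 + (n + n - s) by lia.
  by rewrite /cell e; lia.
have lt_c : cell n (n + n - s) i j < cell N 0 0 0.
  have : i * N + j < N * N.
    apply: (@leq_trans (i * N + N)); first by rewrite ltn_add2l.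
    by rewrite -mulSnr leq_mul2r lt_i orbT.
  rewrite mulSn; lia.
have [_ rU] := hdone n (n + n - s) i j ltac:(lia) lt_i lt_j lt_c.
rewrite subKn // in rU.
have e17 : (Posz (cell N 0 0 0) - Posz (s.+1 * (N * N)) + Posz (i * N + j))%R =
    Posz (cell n (n + n - s) i j) by lia.
split.
- split; [exact: tenv_sem|by rewrite sem_var|exact: done_sem].
- by rewrite sem_var.
- by rewrite /= s18; lia.
move=> i' j' lt_i' lt_j' /=; rewrite s17 s18 s19 e17 rU.
case: eqP => [[e]|ne].
  have [-> ->] := euclid_inj lt_j' lt_j e.
  by rewrite out // addnS ltnS leqnn ltnn addr0.
rewrite out //; congr (_ + _)%R.
have -> // : (i' * N + j' < i * N + j.+1) = (i' * N + j' < i * N + j).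
by rewrite addnS ltnS leq_eqVlt; case: eqP => // e; case: ne; rewrite e.
Qed.

Lemma add_output_correct st :
  tinv s (cell N 0 0 0) st -> vars st 19 = Posz (s * (N * N)) ->
  (forall i j, i < N -> j < N -> arrs st 3 (Posz (i * N + j)) = acc i j) ->
  let st' := sem add_output st in
  [/\ tenv s st', vars st' 19 = Posz (s.+1 * (N * N)) &
      forall i j, i < N -> j < N ->
        arrs st' 3 (Posz (i * N + j)) = (acc i j + cU s i j)%R].
Proof.
move=> inv s19 out st'.
pose st0 := set_var (set_var st 19 (vars st 19 + vars st 4)%R) 18 0%R.
have inv0 : out_inv (0 * N + 0) st0.
  have [[env0 env1 env2 env3 env4 env5 env12 env7 env8] s17 hdone] := inv.
  split=> //; first by rewrite /= s19 env4; lia.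
  by move=> i j lt_i lt_j; rewrite /= out // addr0.
have e' : st' = sem (PFor 15 2 (PFor 16 2 out_body)) st0 by [].
suff [[env _ _] s19' _ out'] : out_inv (N * N + 0) st'.
  split=> // i j lt_i lt_j; rewrite out' // addn0 ifT //.
  apply: (@leq_trans (i * N + N)); first by rewrite ltn_add2l.
  by rewrite -mulSnr leq_mul2r lt_i orbT.
have envN u d : out_inv d u -> vars u 2 = Posz N by case=> -[/env_N].
rewrite e'; apply: (@sem_for_ind (fun i st => out_inv (i * N + 0) st)) => //.
- exact: envN inv0.
- exact: out_inv_set.
move=> i st1 lt_i s15 inv1; apply: out_inv_set => //.
have -> : i.+1 * N + 0 = i * N + N by rewrite mulSnr addn0.
apply: (@sem_for_ind (fun j st => out_inv (i * N + j) st)) => //.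
- exact: envN inv1.
- exact: out_inv_set.
by move=> j st2 lt_j s16 inv2; apply: out_inv_set => //; apply: out_body_correct.
Qed.

End Add.

Lemma tenv_incr k st : tenv k st -> tenv k.+1 (incr_var 12 st).
Proof. by case=> *; split=> //=; lia. Qed.

Lemma main_correct st K : K <= n + n -> tenv 0 st -> vars st 6 = Posz K.+1 ->
  vars st 19 = 0%R -> (forall z, arrs st 3 z = 0%R) ->
  forall i j, i < N -> j < N ->
  arrs (sem tutte_main st) 3 (Posz (i * N + j)) = (\sum_(s < K.+1) cU s i j)%R.
Proof.
move=> le_K env s6 s19 out0.
pose I k st := [/\ tenv k st, vars st 19 = Posz (k * (N * N)) &
  forall i j, i < N -> j < N ->
    arrs st 3 (Posz (i * N + j)) = (\sum_(s < k) cU s i j)%R].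
suff [] : I K.+1 (sem tutte_main st) by [].
apply: sem_for_ind => //.
  split=> //; last by move=> i j _ _; rewrite big_ord0 /= out0.
  by case: env => *; split.
move=> k st1 lt_k s12 [env1 s19' out1].
have inv2 := fill_correct hi_le lo_le env1.
have [|||env3 s19'' out3] := @add_output_correct k (fun i j => \sum_(s < k) cU s i j)%R _
  (sem fill_table st1) inv2; first by lia.
- by rewrite sem_var.
- by move=> i j lt_i lt_j; rewrite sem_arr // out1.
split.
- exact: tenv_incr.
- by rewrite incr_var_neq.
by move=> i j lt_i lt_j; rewrite big_ord_recr; exact: out3.
Qed.

End Output.

(** * Preprocessing: dimensions, positions, expiry and opening counts *)

Definition set_dims := PSeq (PSet 2 (AAdd $0 (ANum 1))) (PSet 3 (AAdd $2 $0)).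

(** Products are formed by repeated addition, since the machine does not multiply. *)
Definition square_loop := PFor 8 2 (PSet 4 (AAdd $4 $2)).
Definition stride_loop := PFor 8 3 (PSet 5 (AAdd $5 $4)).
Definition pos_loop := PFor 8 0 (PSeq (PPut 4 $7 $8) (PSet 7 (AGet 0 $7))).

(** The idle branch assigns [x] to itself, there being no empty [prog]. *)
Definition tick b x := PIf b (PSet x (AAdd $x (ANum 1))) (PSet x $x).

Definition count_body :=
  PSeq (tick (BLt (AGet 4 (AGet 2 $9)) $8) 10)
 (PSeq (tick (BLe (AGet 4 (AGet 1 $9)) $8) 11)
       (tick (BLt (AGet 4 (AGet 2 $9)) (AGet 4 (AGet 1 $9))) 11)).

Definition store_counts := PSeq (PPut 7 $8 $10) (PPut 8 $8 $11).

Definition count_row :=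
  PSeq (PSet 10 (ANum 0)) (PSeq (PSet 11 (ANum 0))
    (PSeq (PFor 9 1 count_body) store_counts)).

Definition count_loop := PFor 8 2 count_row.

Definition preprocess :=
  PSeq square_loop (PSeq stride_loop (PSeq pos_loop count_loop)).

Definition set_nstarts := PSet 6 (AAdd (AGet 8 (ANum 0)) (ANum 1)).

(** Four separately compiled pieces: [set_dims] and [set_nstarts] assign variables that bound later
    loops, and within one [prog] bounds must stay unmodified. *)
Definition tutte_cmd :=
  CSeq (compile set_dims) (CSeq (compile preprocess)
  (CSeq (compile set_nstarts) (compile tutte_main))).

Lemma mul_loop_correct x y z st (Y Z : nat) : x != y -> x != z ->
  x != 8 -> y != 8 -> z != 8 ->
  vars st x = 0%R -> vars st y = Posz Y -> vars st z = Posz Z ->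
  vars (sem (PFor 8 z (PSet x (AAdd $x $y))) st) x = Posz (Z * Y).
Proof.
move=> xy xz x8 y8 z8 sx sy sz.
pose I k st := vars st x = Posz (k * Y) /\ vars st y = Posz Y.
suff [] : I Z (sem (PFor 8 z (PSet x (AAdd $x $y))) st) by [].
apply: sem_for_ind => //; first by rewrite inE eq_sym.
  by rewrite /I /= (negbTE x8) (negbTE y8) sx sy.
move=> k t lt_k _ [tx ty]; rewrite /I /= (negbTE x8) (negbTE y8) eqxx.
by rewrite [y == x]eq_sym (negbTE xy) tx ty; split; lia.
Qed.

Lemma tick_correct b x st :
  vars (sem (tick b x) st) x = (vars st x + Posz (beval st b))%R.
Proof. by rewrite /=; case: ifP => _ /=; rewrite eqxx ?addr0. Qed.

Lemma sum_ord_lt m (k : 'I_m) (G : 'I_m -> nat) :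
  \sum_(i < m | i < k.+1) G i = \sum_(i < m | i < k) G i + G k.
Proof.
rewrite (bigD1 k) //= addnC; congr (_ + _); apply: eq_bigl => i.
by rewrite ltnS ltn_neqAle andbC.
Qed.

Section Counting.
Variables (n m : nat) (F L : 'I_m -> nat).

Definition first_last st := forall j : 'I_m,
  arrs st 4 (arrs st 1 (Posz j)) = Posz (F j) /\
  arrs st 4 (arrs st 2 (Posz j)) = Posz (L j).

Definition count_inv t k st := [/\ first_last st, vars st 8 = Posz t,
  vars st 10 = Posz (\sum_(i < m | i < k) (L i < t)) &
  vars st 11 = Posz (\sum_(i < m | i < k) (wraps F L i + (F i <= t)))].

Lemma count_body_correct t k st : k < m -> vars st 9 = Posz k ->
  count_inv t k st -> count_inv t k.+1 (incr_var 9 (sem count_body st)).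
Proof.
move=> lt_k s9 [fl s8 s10 s11]; pose o := Ordinal lt_k.
have [f4 l4] : arrs st 4 (arrs st 1 (Posz k)) = Posz (F o) /\
  arrs st 4 (arrs st 2 (Posz k)) = Posz (L o) by apply: fl o.
set b1 := BLt (AGet 4 (AGet 2 $9)) $8; set b2 := BLe (AGet 4 (AGet 1 $9)) $8.
set b3 := BLt (AGet 4 (AGet 2 $9)) (AGet 4 (AGet 1 $9)).
set st1 := sem (tick b1 10) st; set st2 := sem (tick b2 11) st1.
have E : sem count_body st = sem (tick b3 11) st2 by [].
have v1 z : z != 10 -> vars st1 z = vars st z by move=> hz; rewrite sem_var //= !inE orbb.
have v2 z : z != 11 -> vars st2 z = vars st1 z by move=> hz; rewrite sem_var //= !inE orbb.
have a1 a z : arrs st1 a z = arrs st a z by rewrite sem_arr.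
have a2 a z : arrs st2 a z = arrs st1 a z by rewrite sem_arr.
have e1 : beval st b1 = (L o < t) by rewrite /= s8 s9 l4 -ltnNge.
have e2 : beval st1 b2 = (F o <= t) by rewrite /= !v1 // !a1 s8 s9 f4.
have e3 : beval st2 b3 = (L o < F o).
  by rewrite /= v2 // v1 // !a2 !a1 s9 f4 l4 -ltnNge.
rewrite E; split.
- by move=> j; rewrite !(sem_arr (p := tick b3 11)) // !a2 !a1; apply: fl.
- by rewrite incr_var_neq // sem_var // v2 // v1.
- rewrite incr_var_neq // sem_var // v2 // tick_correct e1 s10 (sum_ord_lt o).
  by rewrite PoszD.
rewrite incr_var_neq // tick_correct e3 tick_correct e2 v1 // s11 (sum_ord_lt o).
by rewrite -addrA -!PoszD /wraps [X in _ = Posz (_ + X)]addnC.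
Qed.

Lemma count_loop_correct st : vars st 2 = Posz n.+1 -> vars st 1 = Posz m ->
  first_last st -> forall t, t <= n ->
  arrs (sem count_loop st) 7 (Posz t) = Posz (lo_count L t) /\
  arrs (sem count_loop st) 8 (Posz t) = Posz (hi_count F L t).
Proof.
move=> s2 s1 fl.
pose I k st := [/\ first_last st, vars st 1 = Posz m & forall t, t < k ->
  arrs st 7 (Posz t) = Posz (lo_count L t) /\
  arrs st 8 (Posz t) = Posz (hi_count F L t)].
suff [_ _ h] : I n.+1 (sem count_loop st) by move=> t le_t; apply: h.
apply: sem_for_ind => // t st1 lt_t s8 [fl1 s1' done1].
set st2 := set_var (set_var st1 10 0%R) 11 0%R.
have -> : sem count_row st1 = sem store_counts (sem (PFor 9 1 count_body) st2) by [].
have [fl3 s8' s10 s11] : count_inv t m (sem (PFor 9 1 count_body) st2).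
  apply: (@sem_for_ind (count_inv t)) => //.
    by split=> //=; rewrite big1 // => i.
  by move=> k u lt_k; apply: count_body_correct.
have arr3 a z : a \in [:: 7; 8] -> arrs (sem (PFor 9 1 count_body) st2) a z = arrs st1 a z.
  by rewrite !inE => /orP[]/eqP ->; rewrite sem_arr.
have s1'' : vars (sem (PFor 9 1 count_body) st2) 1 = Posz m by rewrite sem_var.
move: (sem (PFor 9 1 count_body) st2) fl3 s8' s10 s11 arr3 s1''.
move=> st3 fl3 s8' s10 s11 arr3 s1''.
split=> //= u; rewrite ltnS leq_eqVlt s8' s10 s11 => /orP[/eqP ->|lt_u].
  rewrite eqxx; split; congr Posz; apply: eq_bigl => i; exact: ltn_ord.
rewrite !arr3 //; have -> : (Posz u == Posz t) = false.
  by apply/eqP => -[e]; rewrite e ltnn in lt_u.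
exact: done1.
Qed.

End Counting.

Section Positions.
Variables (S : finType) (sigma : {perm S}).
Hypothesis sigma_cyclic : cyclic_perm sigma.
Local Notation pos := (pos sigma).

Lemma elt_code_inj : injective (@elt_code S).
Proof. by move=> x y [/val_inj/enum_rank_inj]. Qed.

Lemma arr_of_enum (T : finType) (g : T -> int) x :
  arr_of_seq [seq g y | y <- enum T] (Posz (enum_rank x)) = g x.
Proof. by rewrite /= (nth_map x) -?cardE // nth_enum_rank. Qed.

(** Variable 7 is initially 0, so the walk of [pos_loop] begins at the cut. *)
Lemma elt_code_first (x : S) : elt_code (first_elt x) = 0%R.
Proof.
have S_gt0 : 0 < #|S| by apply/card_gt0P; exists x.
have -> : first_elt x = enum_val (Ordinal S_gt0) by rewrite (enum_val_nth x).
by rewrite /elt_code enum_valK.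
Qed.

Lemma pos_iter_first k x : k < #|S| -> pos (iter k sigma (first_elt x)) = k.
Proof.
move=> lt_k; rewrite -[RHS](pos_elt sigma_cyclic (Ordinal lt_k)) /elt /=.
by rewrite (first_eltE x (enum_val (Ordinal lt_k))).
Qed.

Lemma pos_loop_correct st : vars st 0 = Posz #|S| -> vars st 7 = 0%R ->
  (forall x, arrs st 0 (elt_code x) = elt_code (sigma x)) ->
  forall x, arrs (sem pos_loop st) 4 (elt_code x) = Posz (pos x).
Proof.
move=> s0 s7 a0.
(* The quantifier over x lets the invariant mention the first element even though S may be empty. *)
pose I k st := [/\ forall x, arrs st 0 (elt_code x) = elt_code (sigma x),
  forall x, vars st 7 = elt_code (iter k sigma (first_elt x)) &
  forall x, pos x < k -> arrs st 4 (elt_code x) = Posz (pos x)].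
suff [_ _ h] : I #|S| (sem pos_loop st) by move=> x; apply/h/pos_lt.
apply: sem_for_ind => //; first by split=> //= x; rewrite elt_code_first.
move=> k st1 lt_k s8 [{}a0 {}s7 a4]; split=> [x|x|x] /=.
- exact: a0.
- by rewrite (s7 x) a0.
rewrite ltnS s8 (s7 x) => le_x; case: eqP => [/elt_code_inj e|ne].
  by rewrite e pos_iter_first.
apply: a4; rewrite ltn_neqAle le_x andbT; apply/eqP => e; apply: ne.
by rewrite -e iter_pos.
Qed.

End Positions.

(** * Running time and output of the whole program *)

Lemma compile_exec_bounded p B s : wf_prog p -> loop_depth p <= 6 ->
  all (fun y => (y \notin mod_vars p) && (vars s y <= Posz B)%R) (bound_vars p) ->
  exists2 k, exec (compile p) s k (sem p s) & k <= prog_weight p * B.+1 ^ 6.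
Proof.
move=> wp dp /allP bnd.
have [//|y /bnd/andP//|k e le_k] := compile_exec (V := mod_vars p) wp (B := B) (s := s).
exists k => //; apply: leq_trans le_k _.
by rewrite leq_mul2l leq_pexp2l ?orbT.
Qed.

Definition tutte_weight := prog_weight set_dims + prog_weight preprocess +
  prog_weight set_nstarts + prog_weight tutte_main.

(** [(n + n).+2] is B + 1 for the bound B = 2n + 1 on all loops; the deepest nest has five loops,
    within the exponent 6. *)
Definition tutte_time n := tutte_weight * (n + n).+2 ^ 6.

Lemma bigO_tutte_time : bigO tutte_time (fun n => n ^ 6).
Proof.
(* For n >= 1, 2n + 2 <= 4n. *)
exists (tutte_weight * 4 ^ 6), 1 => n n_gt0; rewrite /tutte_time -mulnA -expnMn.
by apply: leq_mul => //; rewrite leq_exp2r //; lia.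
Qed.

Section Correctness.
Variables (S : finType) (sigma : {perm S}) (m : nat) (f l : 'I_m -> S).
Hypothesis sigma_cyclic : cyclic_perm sigma.
Let A (j : 'I_m) := sigma_interval sigma (f j) (l j).
Hypothesis A_antichain : antichain A.
Local Notation n := #|S|.
Let F j := pos sigma (f j).
Let L j := pos sigma (l j).
Let lo := lo_count L.
Let hi := hi_count F L.
Let st0 := input_state sigma f l.
Let st1 := sem set_dims st0.
Let st2 := sem preprocess st1.
Let st3 := sem set_nstarts st2.

Let m_le : m <= n := leq_nintervals sigma_cyclic A_antichain.

Let lo_le t : lo t <= n + n.
Proof. by have := sum_bool_le (fun j => L j < t); rewrite /lo /lo_count; lia. Qed.

Let hi_le t : hi t <= n + n.
Proof.
by have /andP[_] := hi_count_bounds F L t; have := nwraps_le F L; rewrite /hi; lia.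
Qed.

Lemma dims_env : [/\ vars st1 0 = Posz n, vars st1 1 = Posz m,
  vars st1 2 = Posz n.+1 & vars st1 3 = Posz (n + n).+1].
Proof. by split=> //=; lia. Qed.

Lemma preprocess_env : tenv n m lo hi 0 st2.
Proof.
have [s0 s1 s2 s3] := dims_env.
pose ta := sem square_loop st1; pose tb := sem stride_loop ta.
pose tc := sem pos_loop tb.
have e2 : st2 = sem count_loop tc by [].
have ta4 : vars ta 4 = Posz (n.+1 * n.+1).
  by apply: (@mul_loop_correct 4 2 2 st1).
have tb5 : vars tb 5 = Posz ((n + n).+1 * (n.+1 * n.+1)).
  by apply: (@mul_loop_correct 5 4 3 ta) => //; rewrite sem_var.
have tc4 : forall x, arrs tc 4 (elt_code x) = Posz (pos sigma x).
  apply: pos_loop_correct => //; try by rewrite !sem_var.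
  by move=> x; rewrite !sem_arr //; apply: (arr_of_enum (fun y => elt_code (sigma y))).
have code (j : 'I_m) (g : 'I_m -> S) :
    arr_of_seq [seq elt_code (g i) | i <- enum 'I_m] (Posz j) = elt_code (g j).
  by rewrite /= (nth_map j) ?size_enum_ord // nth_ord_enum.
have fl : first_last F L tc.
  have a12 a z : a \in [:: 1; 2] -> arrs tc a z = arrs st0 a z.
    by rewrite !inE => /orP[]/eqP ->; rewrite !sem_arr.
  by move=> j; rewrite (a12 1) // (a12 2) // [arrs st0 1 _]code [arrs st0 2 _]code !tc4.
have [tc1 tc2] : vars tc 1 = Posz m /\ vars tc 2 = Posz n.+1 
  by split; rewrite /tc sem_var // /tb sem_var // /ta sem_var.
have cnt := count_loop_correct tc2 tc1 fl.
split; try by rewrite (sem_var (p := preprocess)).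
- by rewrite e2 sem_var // /tc sem_var // /tb sem_var.
- by rewrite e2 sem_var // /tc sem_var.
- by move=> t /cnt[].
by move=> t /cnt[].
Qed.

Lemma start_env : [/\ tenv n m lo hi 0 st3, vars st3 6 = Posz (hi 0).+1,
  vars st3 19 = 0%R & forall z, arrs st3 3 z = 0%R].
Proof.
have env := preprocess_env; split.
- exact: tenv_sem.
- by rewrite /= (env_hi env) //; lia.
- by rewrite !sem_var.
by move=> z; rewrite !sem_arr.
Qed.

Lemma tutte_exec :
  exists2 k, exec tutte_cmd st0 k (sem tutte_main st3) & k <= tutte_time n.
Proof.
have [s0 s1 s2 s3] := dims_env; have [env s6 _ _] := start_env.
have [//|//|//|k1 e1 le1] := @compile_exec_bounded set_dims (n + n).+1 st0.
have [//|//||k2 e2 le2] := @compile_exec_bounded preprocess (n + n).+1 st1.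
  move: (st1) s0 s1 s2 s3 => st /= -> -> -> ->.
  have mB : m <= (n + n).+1 by apply: leq_trans m_le _; lia.
  by rewrite !lez_nat mB; lia.
have [//|//|//|k3 e3 le3] := @compile_exec_bounded set_nstarts (n + n).+1 st2.
have [//|//||k4 e4 le4] := @compile_exec_bounded tutte_main (n + n).+1 st3.
  move: (st3) s6 (env_N env) (env_P env) => st /= -> -> ->.
  have hB : (hi 0).+1 <= (n + n).+1 by apply: hi_le.
  by rewrite !lez_nat hB; lia.
exists (k1 + (k2 + (k3 + k4))).
  exact: ExecSeq e1 (ExecSeq e2 (ExecSeq e3 e4)).
rewrite /tutte_time /tutte_weight 3!mulnDl -2!addnA.
exact: leq_add le1 (leq_add le2 (leq_add le3 le4)).
Qed.

Lemma tutte_output :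
  output_poly n (sem tutte_main st3) = tutte (transversal_matroid A).
Proof.
have [env s6 s19 out0] := start_env.
(* All degrees are at most n, so the cells that are read out determine the polynomial. *)
rewrite -[RHS](@poly2_expand n); last exact: coef_tutte_eq0.
apply: eq_bigr => i _; apply: eq_bigr => j _; congr (_%:P%:P * _ * _)%R.
rewrite (main_correct hi_le lo_le (hi_le 0) env s6 s19 out0) //.
by rewrite (tutte_tabU sigma_cyclic A_antichain) !coef_sum.
Qed.

End Correctness.

Theorem theorem4p3 :
  exists (P : cmd) (T : nat -> nat),
    bigO T (fun n => n ^ 6) /\
    forall (S : finType) (sigma : {perm S}) (m : nat) (f l : 'I_m -> S),
      cyclic_perm sigma ->
      antichain (fun j => sigma_interval sigma (f j) (l j)) ->
      exists (k : nat) (s : state),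
        [/\ exec P (input_state sigma f l) k s,
            k <= T #|S| &
            output_poly #|S| s =
              tutte (transversal_matroid
                       (fun j => sigma_interval sigma (f j) (l j)))].
Proof.
exists tutte_cmd, tutte_time; split; first exact: bigO_tutte_time.
move=> S sigma m f l cyc anti; have [k e le_k] := tutte_exec cyc anti.
by exists k, (sem tutte_main (sem set_nstarts (sem preprocess
  (sem set_dims (input_state sigma f l))))); split=> //; apply: tutte_output.
Qed.
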